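(* Let $\Bbbk$ be a field, let $n\ge 1$, let $P_n$ be the path on vertices $x_1,\dots,x_n$ with edges $\{x_i,x_{i+1}\}$ for $1\le i\le n-1$, and let $\mathcal C$ be a maximal (with respect to inclusion) independent set of $P_n$. Let $R=\Bbbk[x_1,\dots,x_n]$, $S=R[z]$, and let $G=P_n(\mathcal C)$ be the $\mathcal C$-suspension of $P_n$ with new vertex $z$. Then $$\operatorname{pdim} S/I(G)=\operatorname{pdim} R/I(P_n)+1.$$
   Context: For a finite simple graph $H$ whose vertices are identified with the variables of a polynomial ring over $\Bbbk$, the edge ideal $I(H)$ is the ideal generated by the products $uv$ over all edges $\{u,v\}$ of $H$. An independent set is a set of pairwise non-adjacent vertices. For a graph $H$ and $\mathcal C\subseteq V(H)$, the $\mathcal C$-suspension $H(\mathcal C)$ is obtained from $H$ by adjoining a new vertex $z$ joined to every vertex of $\mathcal C$ and to no other vertices; thus $I(G)=I(P_n)+(zx_i:x_i\in\mathcal C)\subseteq S$. $\operatorname{pdim}$ denotes projective dimension over the polynomial ring in question ($S$ for $S/I(G)$, $R$ for $R/I(P_n)$). *)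

(* Defs.v *)
From HB Require Import structures.
From mathcomp Require Import all_boot all_algebra.
From mathcomp Require Import generic_quotient ring_quotient.
From mathcomp Require Import boolp mpoly.

Set Implicit Arguments.
Unset Strict Implicit.
Unset Printing Implicit Defensive.

Import GRing.Theory.
Local Open Scope ring_scope.
Local Open Scope quotient_scope.

Section IdealQuotient.
Variables (A : comNzRingType) (gs : seq A).

Definition ideal_gen : {pred A} := fun p =>
  `[< exists c : 'I_(size gs) -> A, p = \sum_(i < size gs) c i * gs`_i >].

Lemma ideal_genP p :
  reflect (exists c : 'I_(size gs) -> A, p = \sum_(i < size gs) c i * gs`_i)
          (p \in ideal_gen).
Proof. exact: asboolP. Qed.

Fact ideal_gen_zmod_closed : zmod_closed ideal_gen.
Proof.
split=> [|p q /ideal_genP[c ->] /ideal_genP[d ->]]; apply/ideal_genP.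
  by exists (fun=> 0); rewrite big1 // => i _; rewrite mul0r.
exists (fun i => c i - d i); rewrite -sumrB.
by apply: eq_bigr => i _; rewrite mulrBl.
Qed.

HB.instance Definition _ :=
  GRing.isZmodClosed.Build A ideal_gen ideal_gen_zmod_closed.

Lemma ideal_genM a p : p \in ideal_gen -> a * p \in ideal_gen.
Proof.
move=> /ideal_genP[c ->]; apply/ideal_genP; exists (fun i => a * c i).
by rewrite mulr_sumr; apply: eq_bigr => i _; rewrite mulrA.
Qed.

(* MathComp's {ideal_quot _} requires a proper ideal and carries no module
   structure over the base ring, so we put one on the additive quotient. *)
Definition quot_mod : Type := Quotient.quot ideal_gen.
HB.instance Definition _ := GRing.Zmodule.on quot_mod.
HB.instance Definition _ := EqQuotient.on quot_mod.

Definition quot_scale (a : A) (x : quot_mod) : quot_mod :=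
  \pi_quot_mod (a * repr x).

Lemma pi_quotP p q :
  \pi_quot_mod p = \pi_quot_mod q <-> p - q \in ideal_gen.
Proof.
split=> [pq|pq]; first by rewrite Quotient.idealrBE; apply/eqP.
by apply/eqP; move: pq; rewrite Quotient.idealrBE.
Qed.

Lemma pi_quotD p q :
  \pi_quot_mod (p + q) = \pi_quot_mod p + \pi_quot_mod q.
Proof. exact: (raddfD (\pi_(Quotient.quot ideal_gen))). Qed.

Lemma pi_quot_scale a p :
  quot_scale a (\pi_quot_mod p) = \pi_quot_mod (a * p).
Proof.
apply/pi_quotP; rewrite -mulrBr; apply: ideal_genM.
by apply/pi_quotP; rewrite reprK.
Qed.

Fact quot_scaleA a b x : quot_scale a (quot_scale b x) = quot_scale (a * b) x.
Proof. by rewrite -[x]reprK (pi_quot_scale b (repr x)) !pi_quot_scale mulrA. Qed.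

Fact quot_scale1 : left_id 1 quot_scale.
Proof. by move=> x; rewrite -[x]reprK pi_quot_scale mul1r. Qed.

Fact quot_scaleDr : right_distributive quot_scale +%R.
Proof.
move=> a x y; rewrite -[x]reprK -[y]reprK.
by rewrite -pi_quotD !pi_quot_scale mulrDr pi_quotD.
Qed.

Fact quot_scaleDl x : {morph quot_scale^~ x : a b / a + b}.
Proof. by move=> a b; rewrite /quot_scale mulrDl pi_quotD. Qed.

HB.instance Definition _ := GRing.Zmodule_isLmodule.Build A quot_mod
  quot_scaleA quot_scale1 quot_scaleDr quot_scaleDl.

End IdealQuotient.

Section ProjectiveDimension.
Variable A : comNzRingType.

Definition projective (P : lmodType A) : Prop :=
  forall (U V : lmodType A) (g : {linear U -> V}) (f : {linear P -> V}),
    (forall v, exists u, g u = v) ->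
    exists h : {linear P -> U}, forall x, g (h x) = f x.

Record proj_resolution (M : lmodType A) := ProjResolution {
  res_mod : nat -> lmodType A;
  res_diff : forall i, {linear res_mod i.+1 -> res_mod i};
  res_aug : {linear res_mod 0 -> M};
  res_proj : forall i, projective (res_mod i);
  res_aug_surj : forall m, exists x, res_aug x = m;
  res_exact0 : forall x, res_aug x = 0 <-> exists y, res_diff 0 y = x;
  res_exact : forall i x,
    res_diff i x = 0 <-> exists y, res_diff i.+1 y = x
}.

Definition pdim_le (M : lmodType A) (d : nat) : Prop :=
  exists F : proj_resolution M,
    forall i, (d < i)%N -> forall x : res_mod F i, x = 0.

(* [None] stands for infinite projective dimension; the zero module is given
   dimension 0. *)
Definition pdim (M : lmodType A) : option nat :=
  match pselect (exists d, `[< pdim_le M d >]) with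
  | left ex => Some (ex_minn ex)
  | right _ => None
  end.

End ProjectiveDimension.

Arguments pdim A M : clear implicits.

Record sgraph (n : nat) := SGraph {
  adj :> rel 'I_n;
  adj_sym : ssrbool.symmetric adj;
  adj_irrefl : irreflexive adj
}.

Definition independent n (H : sgraph n) (C : {set 'I_n}) : bool :=
  [forall i in C, forall j in C, ~~ H i j].

Definition path_adj n : rel 'I_n :=
  fun i j => (i.+1 == j :> nat) || (j.+1 == i :> nat).

Fact path_adj_sym n : ssrbool.symmetric (@path_adj n).
Proof. by move=> i j; rewrite /path_adj orbC. Qed.

Fact path_adj_irrefl n : irreflexive (@path_adj n).
Proof. by move=> i; rewrite /path_adj orbb gtn_eqF. Qed.

Definition path_graph n : sgraph n :=
  SGraph (@path_adj_sym n) (@path_adj_irrefl n).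

(* The suspension lives on 'I_n.+1: the new vertex z is [ord_max], and
   [unlift ord_max] returns [Some i] on the copy of an old vertex i, [None]
   on z. *)
Definition suspension_adj n (H : sgraph n) (C : {set 'I_n}) : rel 'I_n.+1 :=
  fun u v =>
    match unlift ord_max u, unlift ord_max v with
    | Some i, Some j => H i j
    | Some i, None => i \in C
    | None, Some j => j \in C
    | None, None => false
    end.

Fact suspension_adj_sym n (H : sgraph n) C :
  ssrbool.symmetric (suspension_adj H C).
Proof.
move=> u v; rewrite /suspension_adj.
by case: unlift => [i|]; case: unlift => [j|] //; rewrite adj_sym.
Qed.

Fact suspension_adj_irrefl n (H : sgraph n) C :
  irreflexive (suspension_adj H C).
Proof.
by move=> u; rewrite /suspension_adj; case: unlift => // i; rewrite adj_irrefl.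
Qed.

Definition suspension n (H : sgraph n) (C : {set 'I_n}) : sgraph n.+1 :=
  SGraph (@suspension_adj_sym n H C) (@suspension_adj_irrefl n H C).

(* The edge ideal I(H) is [ideal_gen (edge_gens K H)], and [quot_mod] of these
   generators is k[V(H)]/I(H); each edge is listed in both orientations. *)
Definition edge_gens (K : fieldType) n (H : sgraph n) : seq {mpoly K[n]} :=
  [seq 'X_e.1 * 'X_e.2 | e <- enum {: 'I_n * 'I_n} & H e.1 e.2].

(* Main.v *)
From HB Require Import structures.
Require Import Defs.
From mathcomp Require Import all_boot all_algebra zify.
From mathcomp Require Import generic_quotient ring_quotient.
From mathcomp Require Import boolp freeg mpoly.

(** Both projective dimensions are computed: [pdim R/I(P_n) = floor (2n/3)] and
    [pdim S/I(G) = floor (2n/3) + 1].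

    Upper bounds. For a set [U] of vertices let [J_U = I(H) + (x_u : u in U)].
    For [v] outside [U] one has [J_U : x_v = J_(U + N(v))] and
    [J_U + (x_v) = J_(U + v)], hence an exact sequence
    [0 -> S/J_(U + N(v)) -> S/J_U -> S/J_(U + v) -> 0], and the horseshoe lemma
    bounds [pdim S/J_U] by the other two.  For [G] the recursion starts with
    [v = z], whose two branches are [C] together with the edges of [P_n] inside
    the gaps of [C], and [z] together with [I(P_n)].

    Lower bounds. If [pdim M + 2 <= r], the first Koszul cohomology of [M] with
    respect to [r] variables vanishes: a family [m_i] with [x_i m_j = x_j m_i]
    has the form [m_i = x_i m'].  Let [W] be an independent set such that the
    vertices outside the closed neighbourhood of [W] split into nonempty sets
    [X] and [Y] with every edge between them present.  With
    [mu = prod_(w in W) x_w], the family equal to [x_i mu] on [X] and to [0] off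
    [X] is then not of this form in [S/I(H)], so [pdim S/I(H) >= |V| - |W| - 1].
    Removing a vertex from an independent dominating set of about [n/3]
    vertices gives such a [W].  The exceptional case for [G] is when [n] is
    divisible by 3 and [C] misses all vertices [x_2, x_5, ..., x_(n-1)]; then
    some [w] among these has both neighbours in [C], and after removing [w] the
    sets [{w, z}] and [{w-1, w+1}] span a 4-cycle. *)

Set Implicit Arguments.
Unset Strict Implicit.
Unset Printing Implicit Defensive.

Import GRing.Theory.
Local Open Scope ring_scope.
Local Open Scope quotient_scope.

(** * Projective dimension and short exact sequences *)

Section Homological.
Variable A : comNzRingType.
Implicit Types U V W K F M N P Q : lmodType A.

Lemma linear_ofP U V (f : U -> V) :
  linear f -> exists h : {linear U -> V}, h =1 f.
Proof.
move=> lf.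
pose m := GRing.isLinear.Build A U V *:%R f lf.
pose h : {linear U -> V} := HB.pack f m.
by exists h.
Qed.

(** Injectivity of [i] makes the preimages unique, so choosing them gives a linear map. *)
Lemma linear_factor U V W (i : {linear U -> V}) (f : {linear W -> V}) :
  injective i -> (forall x, exists u, i u = f x) ->
  exists h : {linear W -> U}, forall x, i (h x) = f x.
Proof.
move=> i_inj /choice[h hE].
have [|h' h'E] := @linear_ofP _ _ h; last by exists h' => x; rewrite h'E.
by move=> a x y; apply: i_inj; rewrite linearP !hE linearP.
Qed.

Section Kernel.
Variables (U V : lmodType A) (f : {linear U -> V}).

Definition in_kernel : {pred U} := fun x => f x == 0.

Fact in_kernel_submod : submod_closed in_kernel.
Proof.
split=> [|a x y]; rewrite !unfold_in ?linear0 // => /eqP fx /eqP fy.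
by rewrite linearP fx fy scaler0 addr0.
Qed.

HB.instance Definition _ :=
  GRing.isSubmodClosed.Build A U in_kernel in_kernel_submod.

Definition kernel := {x : U | x \in in_kernel}.
HB.instance Definition _ := SubChoice.on kernel.
HB.instance Definition _ := [SubChoice_isSubLmodule of kernel by <:].

End Kernel.

Definition ses K F M (i : {linear K -> F}) (g : {linear F -> M}) :=
  [/\ injective i, forall m, exists x, g x = m
    & forall x, g x = 0 <-> exists k, i k = x].

Lemma kernel_ses F M (g : {linear F -> M}) :
  (forall m, exists x, g x = m) ->
  exists i : {linear kernel g -> F}, ses i g.
Proof.
move=> g_surj; exists (val : {linear kernel g -> F}); split=> // [|x].
  exact: val_inj.
split=> [gx0|[[y /= /eqP gy0] <-] //].
have xk : x \in in_kernel g by apply/eqP.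
by exists (Sub x xk).
Qed.

(** Projective dimension through iterated syzygies, a form suited to induction on [d]; [pdim_leP]
    identifies it with the definition by resolutions. *)
Fixpoint proj_dim_le (d : nat) M : Prop :=
  if d is d'.+1 then
    exists (K P : lmodType A) (i : {linear K -> P}) (g : {linear P -> M}),
      [/\ ses i g, projective P & proj_dim_le d' K]
  else projective M.


Lemma projective_trivial P : (forall x : P, x = 0) -> projective P.
Proof.
move=> P0 U V g f _; exists (\0 : {linear P -> U}) => x.
by rewrite (P0 x) !linear0.
Qed.

(** The sequence splits because [M] is projective, so a map out of [F] can be lifted on the two
    summands separately. *)
Lemma projective_extension P F M (i : {linear P -> F}) (g : {linear F -> M}) :
  ses i g -> projective P -> projective M -> projective F.
Proof.
move=> [i_inj g_surj g_ker] projP projM U V h f h_surj.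
have [s sE] := projM F M g idfun g_surj.
have [|t tE] := @linear_factor _ _ _ i (idfun \- (s \o g)) i_inj.
  by move=> x; apply/g_ker; rewrite /= linearB /= sE subrr.
have [a aE] := projP U V h (f \o i) h_surj.
have [b bE] := projM U V h (f \o s) h_surj.
exists ((a \o t) \+ (b \o g)) => x.
by rewrite /= linearD aE bE /= tE /= -linearD subrK.
Qed.

Lemma pair_ses P Q : exists (i : {linear P -> (P * Q)%type})
  (g : {linear (P * Q)%type -> Q}),
  [/\ ses i g, i =1 (fun x => (x, 0)) & g =1 snd].
Proof.
have [|i iE] := @linear_ofP P (P * Q)%type (fun x => (x, 0)).
  by move=> a x y; congr pair; rewrite /= ?scaler0 ?addr0.
exists i, snd; split=> //; split=> [x y|y|[x y] /=].
- by rewrite !iE => -[].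
- by exists (0, y).
- by split=> [->|[x']]; [exists x; rewrite iE | rewrite iE => -[]].
Qed.

Lemma projective_pair P Q :
  projective P -> projective Q -> projective (P * Q)%type.
Proof. by have [i [g [ig _ _]]] := pair_ses P Q; apply: projective_extension ig. Qed.

Lemma proj_dim_le_iso d M N (f : {linear M -> N}) (h : {linear N -> M}) :
  cancel f h -> cancel h f -> proj_dim_le d M -> proj_dim_le d N.
Proof.
move=> fK hK; case: d => [projM U V g k g_surj|d].
  have [l lE] := projM U V g (k \o f) g_surj.
  by exists (l \o h) => x; rewrite /= lE /= hK.
move=> [K [P [i [g [[i_inj g_surj g_ker] projP pdK]]]]].
exists K, P, i, (f \o g); split=> //; split=> // [y|x /=].
  by have [x gx] := g_surj (h y); exists x; rewrite /= gx.
split=> [fgx0|/g_ker ->]; last exact: linear0.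
by apply/g_ker; apply: (can_inj fK); rewrite linear0.
Qed.

Lemma proj_dim_leS d M : proj_dim_le d M -> proj_dim_le d.+1 M.
Proof.
elim: d M => [|d IHd] M; last first.
  by move=> [K [P [i [g [ig projP /IHd pdK]]]]]; exists K, P, i, g.
(* The row vectors of length 0 serve as the zero module: [M] covers itself with zero kernel. *)
move=> projM; exists 'rV[A]_0, M, (\0 : {linear 'rV[A]_0 -> M}), idfun.
split=> //; last by apply: projective_trivial => x; apply/rowP => -[].
split=> [x y _|m|x /=]; first by apply/rowP => -[].
  by exists m.
by split=> [->|[_ <-]] //; exists 0.
Qed.

Lemma proj_dim_leW d e M : (d <= e)%N -> proj_dim_le d M -> proj_dim_le e M.
Proof.
by move/subnK <-; elim: (e - d)%N => // k IHk /IHk; apply: proj_dim_leS.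
Qed.

(** Horseshoe lemma: covers of [K] and [M] combine into a cover of [F] by their product, and its
    kernel is again an extension of the two kernels. *)
Lemma proj_dim_le_extension d K F M (i : {linear K -> F}) (g : {linear F -> M}) :
  ses i g -> proj_dim_le d K -> proj_dim_le d M -> proj_dim_le d F.
Proof.
elim: d K F M i g => [|d IHd] K F M i g ig; first exact: projective_extension ig.
have [i_inj g_surj g_ker] := ig.
move=> [K1 [P1 [i1 [g1 [[i1_inj g1_surj g1_ker] projP1 pdK1]]]]].
move=> [K2 [P2 [i2 [g2 [[i2_inj g2_surj g2_ker] projP2 pdK2]]]]].
have [s sE] := projP2 _ _ g g2 g_surj.
have [q qE] : exists q : {linear (P1 * P2)%type -> F},
    forall x y, q (x, y) = i (g1 x) + s y.
  by exists (((i \o g1) \o fst) \+ (s \o snd)).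
have q_surj m : exists x, q x = m.
  have [y yE] := g2_surj (g m).
  have [k kE] : exists k, i k = m - s y.
    by apply/g_ker; rewrite linearB sE yE subrr.
  have [x xE] := g1_surj k.
  by exists (x, y); rewrite qE xE kE subrK.
have gi k : g (i k) = 0 by apply/g_ker; exists k.
have [j jE] := kernel_ses q_surj; have [j_inj _ j_ker] := jE.
exists (kernel q), (P1 * P2)%type, j, q; split=> //.
  exact: projective_pair.
have [i12 [_ [_ i12E _]]] := pair_ses P1 P2.
have [|a aE] := @linear_factor _ _ _ j (i12 \o i1) j_inj.
  move=> x; apply/j_ker; rewrite /= i12E qE linear0 addr0.
  by rewrite (_ : g1 _ = 0) ?linear0 //; apply/g1_ker; exists x.
have [|b bE] := @linear_factor _ _ _ i2 (snd \o j) i2_inj.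
  move=> x; apply/g2_ker; rewrite /= -sE.
  have : q (j x) = 0 by apply/j_ker; exists x.
  case: (j x) => u v; rewrite qE /= => /(canRL (addKr _)) ->.
  by rewrite addr0 linearN gi oppr0.
(* The induction runs on the kernel sequence [0 -> K1 -> kernel q -> K2 -> 0]. *)
apply: (IHd _ _ _ a b) pdK1 pdK2; split=> [x y exy|y|x].
- by have := congr1 j exy; rewrite !aE /= !i12E => -[/i1_inj].
- have [k kE] : exists k, i k = - s (i2 y).
    by apply/g_ker; rewrite linearN sE; apply/eqP; rewrite oppr_eq0;
      apply/eqP/g2_ker; exists y.
  have [x xE] := g1_surj k.
  have [z zE] : exists z, j z = (x, i2 y).
    by apply/j_ker; rewrite qE xE kE addNr.
  by exists z; apply: i2_inj; rewrite bE /= zE.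
- split=> [bx0|[y <-]]; last first.
    by apply: i2_inj; rewrite bE linear0 /= aE /= i12E.
  have : q (j x) = 0 by apply/j_ker; exists x.
  have : (snd \o j) x = 0 by rewrite -bE bx0 linear0.
  case jx: (j x) => [u v]; rewrite /= jx qE /= => v0.
  rewrite v0 linear0 addr0 => igu0.
  have /g1_ker[y yE] : g1 u = 0 by apply: i_inj; rewrite linear0.
  by exists y; apply: j_inj; rewrite aE /= i12E yE jx v0.
Qed.

(* Pulling a projective cover of the middle term back to the quotient term. *)
Lemma proj_dim_le_quotient d K F M (i : {linear K -> F}) (g : {linear F -> M}) :
  ses i g -> proj_dim_le d K -> proj_dim_le d F -> proj_dim_le d.+1 M.
Proof.
(* Raising the bound on [F] to [d.+1] provides a cover of [F] even for [d = 0], with a kernel [L] of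
   dimension at most [d]. *)
move=> [i_inj g_surj g_ker] pdK /proj_dim_leS.
move=> [L [P [l [p [[l_inj p_surj p_ker] projP pdL]]]]].
have gp_surj m : exists x, (g \o p) x = m.
  by have [y <-] := g_surj m; have [x <-] := p_surj y; exists x.
have [j [j_inj _ j_ker]] := kernel_ses gp_surj.
exists (kernel (g \o p)), P, j, (g \o p); split=> //.
have [|a aE] := @linear_factor _ _ _ j l j_inj.
  by move=> x; apply/j_ker; rewrite /= (_ : p _ = 0) ?linear0 //; apply/p_ker; exists x.
have [|b bE] := @linear_factor _ _ _ i (p \o j) i_inj.
  by move=> x; apply/g_ker; rewrite /= -[g _]/((g \o p) _); apply/j_ker; exists x.
(* The kernel of [P -> F -> M] is an extension of [K] by [L]. *)
apply: (@proj_dim_le_extension _ _ _ _ a b) pdL pdK; split=> [x y exy|k|x].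
- by apply: l_inj; rewrite -!aE exy.
- have [y yE] := p_surj (i k).
  have [x xE] : exists x, j x = y by apply/j_ker; rewrite /= yE; apply/g_ker; exists k.
  by exists x; apply: i_inj; rewrite bE /= xE.
- split=> [bx0|[y <-]]; last first.
    by apply: i_inj; rewrite bE linear0 /= aE; apply/p_ker; exists y.
  have /p_ker[y yE] : p (j x) = 0 by rewrite -[p _]/((p \o j) _) -bE bx0 linear0.
  by exists y; apply: j_inj; rewrite aE.
Qed.

Lemma projective_regular : projective A^o.
Proof.
move=> U V g f g_surj; have [u uE] := g_surj (f 1).
have [|h hE] := @linear_ofP A^o U (fun a => a *: u).
  by move=> a x y; rewrite scalerDl scalerA.
by exists h => x; rewrite hE linearZ /= uE -linearZ /= [_ *: _]mulr1.
Qed.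

(** * Projective resolutions versus iterated syzygies *)

Definition shift_mod P (F : nat -> lmodType A) (i : nat) : lmodType A :=
  if i is j.+1 then F j else P.

(** The first new differential is the composite of the augmentation with [i]. Only the family of
    modules is recorded, since the vanishing in [pdim_le] depends on nothing else. *)
Lemma proj_resolution_splice M K P (i : {linear K -> P}) (g : {linear P -> M})
    (F : proj_resolution K) :
  ses i g -> projective P ->
  exists G : proj_resolution M, res_mod G = shift_mod P (res_mod F).
Proof.
move=> [i_inj g_surj g_ker] projP.
pose d k : {linear shift_mod P (res_mod F) k.+1 -> shift_mod P (res_mod F) k} :=
  match k with 0 => i \o res_aug F | j.+1 => res_diff F j end.
unshelve eexists (@ProjResolution A M (shift_mod P (res_mod F)) d g _ _ _ _).
- by case=> // k; apply: res_proj.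
- exact: g_surj.
- move=> x; split=> [/g_ker[k <-]|[y <-]].
    by have [y <-] := res_aug_surj F k; exists y.
  by apply/g_ker; exists (res_aug F y).
- case=> [|k] x; last exact: res_exact.
  split=> [|/res_exact0 /= ->]; last exact: linear0.
  by move=> /= ix0; apply/res_exact0/i_inj; rewrite ix0 linear0.
- by [].
Qed.

Lemma proj_resolution_kernel M (F : proj_resolution M) :
  exists G : proj_resolution (kernel (res_aug F)),
    res_mod G = fun i => res_mod F i.+1.
Proof.
have [j [j_inj _ j_ker]] := kernel_ses (@res_aug_surj _ _ F).
have [|a aE] := @linear_factor _ _ _ j (res_diff F 0) j_inj.
  by move=> x; apply/j_ker/res_exact0; exists x.
unshelve eexists (@ProjResolution A _ (fun i => res_mod F i.+1)
  (fun i => res_diff F i.+1) a _ _ _ _).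
- by move=> k; apply: res_proj.
- move=> k; have /res_exact0[x xE] : res_aug F (j k) = 0 by apply/j_ker; exists k.
  by exists x; apply: j_inj; rewrite aE.
- move=> x; split=> [ax0|/res_exact dx0].
    by apply/res_exact; rewrite -aE ax0 linear0.
  by apply: j_inj; rewrite aE dx0 linear0.
- by move=> k x; apply: res_exact.
- by [].
Qed.

Lemma pdim_leP M d : pdim_le M d <-> proj_dim_le d M.
Proof.
split=> [[F F0]|].
  elim: d M F F0 => [|d IHd] M F F0; last first.
    have [j jE] := kernel_ses (@res_aug_surj _ _ F).
    have [G GE] := proj_resolution_kernel F.
    exists (kernel (res_aug F)), (res_mod F 0), j, (res_aug F); split=> //.
      exact: res_proj.
    by apply: (IHd _ G); rewrite GE => k dk; apply: F0.
  (* With nothing above degree 0 the augmentation is an isomorphism, so [M] is projective. *)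
  have aug_inj : injective (res_aug F).
    move=> x y /eqP; rewrite -subr_eq0 -linearB => /eqP/res_exact0[z].
    by rewrite (F0 1%N isT z) linear0 => /esym/eqP; rewrite subr_eq0 => /eqP.
  have [|h hE] := @linear_factor _ _ _ (res_aug F) idfun aug_inj.
    exact: res_aug_surj.
  apply: (@proj_dim_le_iso 0 _ _ (res_aug F) h) (@res_proj _ _ F 0%N) => //.
  by move=> x; apply: aug_inj; rewrite hE.
elim: d M => [|d IHd] M => [projM|[K [P [i [g [ig projP /IHd[F F0]]]]]]].
  have T0 (x : 'rV[A]_0) : x = 0 by apply/rowP => -[].
  pose d i : {linear shift_mod M (fun=> 'rV[A]_0) i.+1
                -> shift_mod M (fun=> 'rV[A]_0) i} := \0.
  unshelve eexists (@ProjResolution A M _ d idfun _ _ _ _).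
  - by case=> [|i] //=; apply: projective_trivial.
  - by move=> m; exists m.
  - by move=> x; split=> [/= ->|[_ <-]] //; exists 0.
  - by move=> i x; split=> [_|[_ <-]] //; exists 0; rewrite [x]T0.
  - by case=> [|i] // _ x; apply: T0.
have [G GE] := proj_resolution_splice F ig projP.
by exists G; rewrite GE; case=> // k dk; apply: F0.
Qed.

Lemma pdim_eq M p : proj_dim_le p M ->
  (forall d, proj_dim_le d M -> (p <= d)%N) -> pdim A M = Some p.
Proof.
move=> pdM minp; rewrite /pdim; case: pselect => [ex|[]]; last first.
  by exists p; apply/asboolP/pdim_leP.
case: ex_minnP => q /asboolP/pdim_leP pdq qmin; congr Some.
by apply/eqP; rewrite eqn_leq minp // qmin //; apply/asboolP/pdim_leP.
Qed.

End Homological.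

(** * Regular sequences and the first Koszul cohomology *)

Section RegularSequences.
Variable A : comNzRingType.
Implicit Types (K F M P : lmodType A) (z : A) (zs : seq A).

(** Membership in the submodule generated by all multiples of elements of [zs]; the recursion on the
    list matches that of [regular]. *)
Fixpoint in_span zs M (m : M) : Prop :=
  if zs is z :: zs' then exists u, in_span zs' (m - z *: u) else m = 0.

Lemma in_span0 zs M : in_span zs (0 : M).
Proof. by elim: zs => //= z zs IHzs; exists 0; rewrite scaler0 subr0. Qed.

Lemma in_span_lin zs M a (m n : M) :
  in_span zs m -> in_span zs n -> in_span zs (a *: m + n).
Proof.
elim: zs m n => [|z zs IHzs] m n /= => [->->|[u mu] [v nv]].
  by rewrite scaler0 addr0.
exists (a *: u + v); rewrite scalerDr opprD addrACA scalerA mulrC -scalerA.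
by rewrite -scalerBr; apply: IHzs.
Qed.

Lemma in_spanD zs M (m n : M) :
  in_span zs m -> in_span zs n -> in_span zs (m + n).
Proof. by move=> zm zn; rewrite -[m]scale1r; apply: in_span_lin. Qed.

Lemma in_spanZ zs M a (m : M) : in_span zs m -> in_span zs (a *: m).
Proof.
by move=> zm; rewrite -[_ *: _]addr0; apply: in_span_lin (in_span0 _ _).
Qed.

Lemma in_spanB zs M (m n : M) :
  in_span zs m -> in_span zs n -> in_span zs (m - n).
Proof. by move=> zm zn; rewrite -[- n]scaleN1r; apply/in_spanD/in_spanZ. Qed.

Lemma in_span_map zs M F (f : {linear M -> F}) m :
  in_span zs m -> in_span zs (f m).
Proof.
elim: zs m => [|z zs IHzs] m /= => [->|[u mu]]; first exact: linear0.
by exists (f u); rewrite -linearZ -linearB; apply: IHzs.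
Qed.

Lemma in_span_lift zs M F (g : {linear F -> M}) m :
  (forall m, exists x, g x = m) -> in_span zs m ->
  exists2 x, in_span zs x & g x = m.
Proof.
move=> g_surj; elim: zs m => [|z zs IHzs] m /= => [->|[u /IHzs[x zx gx]]].
  by exists 0; rewrite ?linear0.
have [v gv] := g_surj u; exists (x + z *: v).
  by exists v; rewrite addrK.
by rewrite linearD linearZ /= gx gv subrK.
Qed.

(** Weakly regular sequences read from the end of the list: each element is a nonzerodivisor on [M]
    modulo the elements after it. *)
Fixpoint regular zs M : Prop :=
  if zs is z :: zs' then
    regular zs' M /\ forall m : M, in_span zs' (z *: m) -> in_span zs' m
  else True.

(** The cancellation behind the cocycle condition for connecting elements in [koszul1_vanishing]:
    [a], [b], [c] come from the lifts, [p], [q], [r] from their defects. *)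
Lemma cocycle_sum (V : zmodType) (a b c p q r : V) :
  (b - c - q) - (a - c - p) + (a - b - r) = p - q - r.
Proof.
rewrite [b - c - q]addrAC [a - c - p]addrAC opprB subrKA opprB.
rewrite [b - q + _]addrA -[a - b - r]addrA subrKA.
by rewrite -[b - q + p]addrA [- q + p]addrC addrACA subrr add0r.
Qed.

Lemma regular_catrev ys zs M : regular (catrev ys zs) M -> regular zs M.
Proof. by elim: ys zs => //= y ys IHys zs /IHys[]. Qed.

(** The map [K -> F] stays injective modulo [zs]. If [i k] is [z *: x] modulo the tail, regularity
    puts [g x] in the tail span, and adding to [x] a lift of [- g x] from that span moves it into
    [K]. *)
Lemma in_span_kernel zs K F M (i : {linear K -> F}) (g : {linear F -> M}) k :
  ses i g -> regular zs M -> in_span zs (i k) -> in_span zs k.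
Proof.
move=> [i_inj g_surj g_ker].
have gi x : g (i x) = 0 by apply/g_ker; exists x.
elim: zs k => [|z zs IHzs] k /= => [_|[regM zM] [x]].
  by move=> ik0; apply: i_inj; rewrite ik0 linear0.
move=> zx; have := in_span_map g zx; rewrite linearB gi sub0r linearZ /= -scalerN.
rewrite -linearN => /zM/(in_span_lift g_surj)[h zh gh].
have [k' ik'] : exists k', i k' = x + h.
  by apply/g_ker; rewrite linearD gh linearN subrr.
exists k'; apply: IHzs => //; rewrite linearB linearZ /= ik' scalerDr opprD addrA.
by apply: in_spanB zx _; apply: in_spanZ.
Qed.

(** Passing to a syzygy gains one regular element: regularity is tested in [F] and pulled back to
    [K], which uses only the shorter sequence on [M]. *)
Lemma regular_kernel z zs K F M (i : {linear K -> F}) (g : {linear F -> M}) :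
  ses i g -> regular zs M -> regular (z :: zs) F -> regular (z :: zs) K.
Proof.
move=> ig; elim: zs z => [|z' zs IHzs] z.
  move=> _ [_ zF]; split=> // k /(in_span_map i); rewrite linearZ => /zF.
  exact: in_span_kernel ig _.
move=> regM [regF zF]; split; first by apply: IHzs => //; case: regM.
move=> k /(in_span_map i); rewrite linearZ => /zF.
exact: in_span_kernel ig _.
Qed.

(* Vanishing of the first Koszul cohomology of [ys] on [K / zs K]; passing to a
   syzygy of [K] moves one element of [ys] into [zs]. *)
Lemma koszul1_vanishing e zs ys K (m : A -> K) :
    proj_dim_le e K -> regular zs K ->
    (forall P, projective P -> regular (catrev ys zs) P) ->
    (e.+1 < size ys)%N ->
    {in ys &, forall y y', in_span zs (y *: m y' - y' *: m y)} ->
  exists m', {in ys, forall y, in_span zs (m y - y *: m')}.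
Proof.
elim: e zs ys K m => [|e IHe] zs [|y1 [|y2 ys]] // K m pdK regK regP szys mE.
  have [[_ y1K] y2K] := regular_catrev (regP K pdK : regular (catrev ys _) K).
  have y1_ys : y1 \in y1 :: y2 :: ys by rewrite inE eqxx.
  have y2_ys : y2 \in y1 :: y2 :: ys by rewrite !inE eqxx orbT.
  (* As [y2] is regular modulo [y1 :: zs], the relation between [m y1] and [m y2] makes [m y1] a
     multiple of [y1] modulo [zs]; the quotient is [m']. *)
  have [|m' m'E] := y2K (m y1).
    by exists (m y2); apply: mE.
  exists m' => y y_ys; apply: y1K.
  have -> : y1 *: (m y - y *: m') =
            (y1 *: m y - y *: m y1) + y *: (m y1 - y1 *: m').
    by rewrite !scalerBr !scalerA [y1 * y]mulrC addrA subrK.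
  by apply: in_spanD (mE _ _ _ _) (in_spanZ _ m'E).
have [K' [F [i [g [ig projF pdK']]]]] := pdK.
have [i_inj g_surj g_ker] := ig.
have gi x : g (i x) = 0 by apply/g_ker; exists x.
have iB u v : i (u - v) = i u - i v by apply: linearB.
have iZ a u : i (a *: u) = a *: i u by apply: linearZ.
have y1_ys : y1 \in y1 :: y2 :: ys by rewrite inE eqxx.
have [[regF y1F] y2F] := regular_catrev (regP F projF : regular (catrev ys _) F).
have regK' : regular (y1 :: zs) K' by apply: regular_kernel ig _ _.
(* Lift the family to [f] on the projective cover; modulo [zs], its failure to be a cocycle is
   measured by elements [k] of the syzygy [K']. *)
have [f fE] := choice (fun y => g_surj (m y)).
have /choice[k kE] : forall yy : A * A, exists k,
    yy.1 \in y1 :: y2 :: ys -> yy.2 \in y1 :: y2 :: ys ->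
    in_span zs (yy.1 *: f yy.2 - yy.2 *: f yy.1 - i k).
  case=> y y' /=.
  have [y_ys|] := boolP (y \in _); last by exists 0.
  have [y'_ys|] := boolP (y' \in _); last by exists 0.
  have [h zh gh] := in_span_lift g_surj (mE _ _ y_ys y'_ys).
  have [x xE] : exists x, i x = y *: f y' - y' *: f y - h.
    by apply/g_ker; rewrite linearB gh linearB !linearZ /= !fE subrr.
  by exists x => _ _; rewrite xE subKr.
(* Modulo [y1 :: zs] the elements [k (y1, y)] form a cocycle on [K'], which has smaller projective
   dimension. *)
have [||k' k'E] // :=
  IHe (y1 :: zs) (y2 :: ys) K' (fun y => k (y1, y)) pdK' regK' regP.
  move=> y y' y_ys y'_ys; exists (k (y, y')).
  have {}y_ys : y \in y1 :: y2 :: ys by rewrite inE y_ys orbT.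
  have {}y'_ys : y' \in y1 :: y2 :: ys by rewrite inE y'_ys orbT.
  apply: in_span_kernel ig regK _.
  have /(in_spanZ y) k1 := kE (y1, y') y1_ys y'_ys.
  have /(in_spanZ y') k2 := kE (y1, y) y1_ys y_ys.
  have /(in_spanZ y1) k3 := kE (y, y') y_ys y'_ys.
  have := in_spanD (in_spanB k2 k1) k3; congr in_span.
  rewrite !(iB, iZ) /= !scalerBr !scalerA.
  by rewrite [y' * y1]mulrC [y' * y]mulrC [y * y1]mulrC cocycle_sum.
have k''E y : y \in y2 :: ys ->
    exists x, in_span zs (y1 *: (f y - i x) - y *: (f y1 + i k')).
  move=> y_ys; have [x xE] := k'E y y_ys; exists x.
  have {}y_ys : y \in y1 :: y2 :: ys by rewrite inE y_ys orbT.
  have := in_spanD (kE (y1, y) y1_ys y_ys) (in_span_map i xE); congr in_span.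
  rewrite scalerBr scalerDr opprD !(iB, iZ) /= !addrA subrK.
  by rewrite -!addrA; congr (_ + _); rewrite addrA addrC.
(* With the corrections [i x] and [i k'], the argument of the projective case applies in [F]; [g]
   kills the corrections. *)
have [f' f'E] : in_span (y1 :: zs) (f y1 + i k').
  apply: y2F; have [|x xE] := k''E y2; first by rewrite inE eqxx.
  by exists (f y2 - i x); have := in_spanZ (-1) xE; rewrite scaleN1r opprB.
exists (g f') => y; rewrite inE => /predU1P[->|y_ys].
  have := in_span_map g f'E.
  by rewrite linearB linearD linearZ /= gi addr0 fE.
have [x xE] := k''E y y_ys.
suff: in_span zs (f y - i x - y *: f').
  by move/(in_span_map g); rewrite !linearB linearZ /= gi subr0 fE.
apply: y1F.
have := in_spanD xE (in_spanZ y f'E); congr in_span.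
by rewrite !scalerBr !scalerA [y1 * y]mulrC addrA subrK.
Qed.

End RegularSequences.

(** * Regular sequences on free and projective modules *)

Section RegularProjective.
Variable A : comNzRingType.

Lemma coeff_linear (T : choiceType) (x : T) :
  exists h : {linear {freeg T / A} -> A^o}, h =1 coeff x.
Proof. by apply: linear_ofP => a u v; rewrite coeffD coeffZ. Qed.

Lemma in_span_sum zs (M : lmodType A) (I : Type) (r : seq I) (F : I -> M) :
  (forall i, in_span zs (F i)) -> in_span zs (\sum_(i <- r) F i).
Proof.
move=> zF; elim/big_rec: _ => [|i m _]; first exact: in_span0.
exact: in_spanD.
Qed.

Lemma in_span_freeg zs (T : choiceType) (u : {freeg T / A}) :
  in_span zs u <-> forall x, in_span zs (coeff x u : A^o).
Proof.
split=> [zu x|zu].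
  by have [h <-] := coeff_linear x; apply: in_span_map.
rewrite -[u]freeg_sumE; apply: in_span_sum => x.
have [|h hE] := @linear_ofP A A^o {freeg T / A} (fun a => << a *g x >>).
  move=> a b c; apply/eqP/freeg_eqP => y.
  by rewrite coeffD coeffZ !coeffU mulrDl mulrA.
by rewrite -hE; apply: in_span_map.
Qed.

Lemma regular_freeg zs (T : choiceType) :
  regular zs A^o -> regular zs {freeg T / A}.
Proof.
elim: zs => //= z zs IHzs [/IHzs regT zA]; split=> // u /in_span_freeg zu.
by apply/in_span_freeg => x; apply: zA; have := zu x; rewrite coeffZ.
Qed.

(** The cover is the free module on the set of elements of [M], each generator going to itself. *)
Lemma freeg_cover (M : lmodType A) :
  exists g : {linear {freeg M / A} -> M}, forall m, exists x, g x = m.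
Proof.
have [|g gE] := @linear_ofP A {freeg M / A} M (fglift id).
  have l0 : fglift (@id M) 0 = 0 by rewrite -[0](subrr 0) lift_is_additive subrr.
  have lD : {morph fglift (@id M) : u v / u + v}.
    move=> u v; rewrite -{1}[v]opprK lift_is_additive; congr (_ + _).
    by rewrite -[- v]sub0r lift_is_additive l0 sub0r opprK.
  have lE (u : {freeg M / A}) c : fglift (@id M) (c *: u) = c *: fglift (@id M) u.
    have -> : c *: u = \sum_(x <- dom u) << c * coeff x u *g x >> by [].
    rewrite -[in RHS](freeg_sumE u) !(big_morph _ lD l0) scaler_sumr.
    by apply: eq_bigr => x _; rewrite !liftU scalerA.
  by move=> a u v; rewrite lD lE.
exists g => m; exists << m >>.
by rewrite gE liftU scale1r.
Qed.

Lemma regular_retract zs (M F : lmodType A) (s : {linear M -> F})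
    (g : {linear F -> M}) :
  cancel s g -> regular zs F -> regular zs M.
Proof.
move=> sK; elim: zs => //= z zs IHzs [/IHzs regM zF]; split=> // m.
move=> /(in_span_map s); rewrite linearZ => /zF/(in_span_map g).
by rewrite sK.
Qed.

(** A projective module is a retract of a free one, where regularity is checked coefficient by
    coefficient. *)
Lemma regular_projective zs (P : lmodType A) :
  regular zs A^o -> projective P -> regular zs P.
Proof.
move=> regA projP; have [g g_surj] := freeg_cover P.
have [s sE] := projP _ _ g idfun g_surj.
by apply: (@regular_retract _ _ _ s g) => //; apply: regular_freeg.
Qed.

End RegularProjective.

(** * Sequences of variables in a polynomial ring *)

Section RegularVariables.
Variables (K : fieldType) (n : nat).
Implicit Types (p q : {mpoly K[n]}) (m : 'X_{1..n}) (i : 'I_n).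

Lemma mnm1_le i m : (U_(i) <= m)%MM = (0 < m i)%N.
Proof.
apply/mnm_lepP/idP => [/(_ i)|mi j]; first by rewrite mnm1E eqxx.
by rewrite mnm1E; case: eqP => // <-.
Qed.

Lemma mcoeffXM i p m :
  ('X_i * p)@_m = if (0 < m i)%N then p@_(m - U_(i)) else 0.
Proof.
rewrite mulrC; case: ifPn => [mi|].
  have {1}-> : m = (U_(i) + (m - U_(i)))%MM; last exact: mcoeffMX.
  by rewrite addmC submK // mnm1_le.
rewrite -eqn0Ngt => /eqP mi; apply/eqP; rewrite mcoeff_eq0.
rewrite (perm_mem (msuppMX p U_(i))); apply/mapP => -[k _ mE].
by move: mi; rewrite mE mnmDE mnm1E eqxx.
Qed.

Lemma mcoeffXM_add i p m : ('X_i * p)@_(m + U_(i)) = p@_m.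
Proof. by rewrite mulrC addmC mcoeffMX. Qed.

Lemma mcoeff_restrict (Q : pred 'X_{1..n}) p m :
  (\sum_(k <- msupp p | Q k) p@_k *: 'X_[k])@_m = if Q m then p@_m else 0.
Proof.
rewrite big_mkcond raddf_sum /=; transitivity
  (\sum_(k <- msupp p) if Q m then (p@_k *: 'X_[k])@_m else 0).
  apply: eq_bigr => k _; rewrite (fun_if (mcoeff m)) mcoeff0 mcoeffZ mcoeffX.
  by case: eqP => [->|_] //; rewrite mulr0 !if_same.
case: (Q m); last by rewrite big1.
by rewrite [in RHS](mpolyE p) raddf_sum.
Qed.

(** Membership in a monomial ideal is a condition on each occurring monomial, so ideal computations
    become statements about exponents. *)
Definition supported (Q : pred 'X_{1..n}) p : Prop := forall m, p@_m != 0 -> Q m.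

Lemma supportedD Q p q : supported Q p -> supported Q q -> supported Q (p + q).
Proof.
move=> Qp Qq m; rewrite mcoeffD; have [->|/Qp //] := eqVneq p@_m 0.
by rewrite add0r => /Qq.
Qed.

Lemma supportedXM Q i p :
  supported Q ('X_i * p) <-> supported (fun m => Q (m + U_(i))%MM) p.
Proof.
split=> [Qp m pm|Qp m]; first by apply: Qp; rewrite mcoeffXM_add.
rewrite mcoeffXM; case: ifP => [mi /Qp|]; last by rewrite eqxx.
by rewrite submK // mnm1_le.
Qed.

Lemma in_span_vars (s : seq 'I_n) p :
  in_span [seq 'X_i | i <- s] (p : {mpoly K[n]}^o)
    <-> supported (fun m => has (fun i => 0 < m i)%N s) p.
Proof.
elim: s p => [|i s IHs] p /=.
  split=> [-> m|p0]; first by rewrite mcoeff0 eqxx.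
  by apply/mpolyP => m; rewrite mcoeff0; apply/eqP/negPn/negP => /p0.
split=> [[q /IHs pq] m|pS].
  rewrite -[p](subrK ('X_i * q)) mcoeffD; have [->|/pq ->] := eqVneq (p - 'X_i * q)@_m 0.
    by rewrite add0r mcoeffXM; case: ifP; rewrite ?eqxx.
  by rewrite orbT.
(* The terms of [p] divisible by ['X_i], divided by it once; no term of [p - 'X_i * q] involves
   ['X_i]. *)
pose q : {mpoly K[n]} :=
  \sum_(m <- msupp p | (0 < m i)%N) p@_m *: 'X_[(m - U_(i))%MM].
exists q; apply/IHs => m.
have -> : 'X_i *: (q : {mpoly K[n]}^o) =
    \sum_(m <- msupp p | (0 < m i)%N) p@_m *: 'X_[m].
  rewrite -[LHS]/('X_i * q) mulr_sumr; apply: eq_bigr => k ki.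
  by rewrite -scalerAr -mpolyXD addmC submK // mnm1_le.
rewrite mcoeffB mcoeff_restrict; case: ifPn => [_|mi]; first by rewrite subrr eqxx.
by rewrite subr0 => /pS; rewrite (negPf mi).
Qed.

(** Multiplication by a variable outside [s] leaves the exponents of the variables in [s]
    unchanged. *)
Lemma regular_vars (s : seq 'I_n) :
  uniq s -> regular [seq 'X_i | i <- s] {mpoly K[n]}^o.
Proof.
elim: s => //= i s IHs /andP[si /IHs regs]; split=> // p.
move=> /in_span_vars/supportedXM ps; apply/in_span_vars => m /ps.
apply: contraTT => /hasPn ms; apply/hasPn => j js; rewrite mnmDE mnm1E.
by case: eqP js si => [-> ->|_ js _]; rewrite ?addn0 ?ms.
Qed.

End RegularVariables.

(** * Quotients by edge ideals *)

Section QuotientMaps.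
Variable A : comNzRingType.
Implicit Types gs hs : seq A.

Lemma mem_ideal_gen gs g : g \in gs -> g \in ideal_gen gs.
Proof.
move=> g_gs; have i_lt : (index g gs < size gs)%N by rewrite index_mem.
apply/ideal_genP; exists (fun j => (j == Ordinal i_lt)%:R).
rewrite (bigD1 (Ordinal i_lt)) //= eqxx mul1r nth_index // big1 ?addr0 // => j.
by move=> /negPf ->; rewrite mul0r.
Qed.

Lemma pi_surj gs (x : quot_mod gs) : exists p, \pi_(quot_mod gs) p = x.
Proof. by exists (repr x); rewrite reprK. Qed.

Lemma pi_eq0 gs p : \pi_(quot_mod gs) p = 0 <-> p \in ideal_gen gs.
Proof.
have pi0 : \pi_(quot_mod gs) 0 = 0.
  by apply: (addIr (\pi_(quot_mod gs) 0)); rewrite -pi_quotD !add0r.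
rewrite -pi0; split=> [/pi_quotP|p_gs]; first by rewrite subr0.
by apply/pi_quotP; rewrite subr0.
Qed.

Lemma quot_mul_map gs hs a :
    (forall p, p \in ideal_gen gs -> a * p \in ideal_gen hs) ->
  exists f : {linear quot_mod gs -> quot_mod hs},
    forall p, f (\pi_(quot_mod gs) p) = \pi_(quot_mod hs) (a * p).
Proof.
move=> agh; pose f (x : quot_mod gs) := \pi_(quot_mod hs) (a * repr x).
have fE p : f (\pi_(quot_mod gs) p) = \pi_(quot_mod hs) (a * p).
  by apply/pi_quotP; rewrite -mulrBr; apply/agh/pi_quotP; rewrite reprK.
have [|h hE] := @linear_ofP _ (quot_mod gs) (quot_mod hs) f; last first.
  by exists h => p; rewrite hE fE.
move=> b x y; have [p <-] := pi_surj x; have [q <-] := pi_surj y.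
rewrite -[b *: _]/(quot_scale _ _) pi_quot_scale -pi_quotD !fE.
by rewrite -[b *: _]/(quot_scale _ _) pi_quot_scale -pi_quotD mulrDr mulrCA.
Qed.

(** With [I] generated by [gs2], the hypotheses say that [gs1] generates [I : a] and [gs3] generates
    [I + (a)]; the maps are multiplication by [a] and projection. *)
Lemma colon_ses gs1 gs2 gs3 a :
    (forall p, (p \in ideal_gen gs1) = (a * p \in ideal_gen gs2)) ->
    {subset ideal_gen gs2 <= ideal_gen gs3} -> a \in ideal_gen gs3 ->
    (forall p, p \in ideal_gen gs3 -> exists q, p - a * q \in ideal_gen gs2) ->
  exists (i : {linear quot_mod gs1 -> quot_mod gs2})
         (g : {linear quot_mod gs2 -> quot_mod gs3}), ses i g.
Proof.
move=> colonE sub23 a3 gen3.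
have [|i iE] := @quot_mul_map gs1 gs2 a; first by move=> p; rewrite colonE.
have [|g gE] := @quot_mul_map gs2 gs3 1; first by move=> p /sub23; rewrite mul1r.
exists i, g; split=> [x y|x|x].
- have [p <-] := pi_surj x; have [q <-] := pi_surj y.
  rewrite !iE => /pi_quotP; rewrite -mulrBr -colonE => pq.
  exact/pi_quotP.
- by have [p <-] := pi_surj x; exists (\pi_(quot_mod gs2) p); rewrite gE mul1r.
- have [p <-] := pi_surj x; rewrite gE mul1r pi_eq0.
  split=> [/gen3[q pq]|[k]].
    by exists (\pi_(quot_mod gs1) q); rewrite iE; apply/esym/pi_quotP.
  have [q <-] := pi_surj k; rewrite iE => /pi_quotP/sub23 aqp.
  rewrite -[p](subKr (a * q)); apply: rpredB => //.
  by rewrite mulrC; apply: ideal_genM.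
Qed.

Lemma quot_mod_eq_ideal gs hs d :
  (forall p, (p \in ideal_gen gs) = (p \in ideal_gen hs)) ->
  proj_dim_le d (quot_mod gs) -> proj_dim_le d (quot_mod hs).
Proof.
move=> eq_gh.
have [|f fE] := @quot_mul_map gs hs 1; first by move=> p; rewrite mul1r eq_gh.
have [|h hE] := @quot_mul_map hs gs 1; first by move=> p; rewrite mul1r eq_gh.
by apply: (@proj_dim_le_iso _ d _ _ f h) => x; have [p <-] := pi_surj x;
  rewrite ?(fE, hE) !mul1r.
Qed.

Lemma quot_mod_nil : proj_dim_le 0 (quot_mod (Nil A)).
Proof.
have piK : injective (\pi_(quot_mod (Nil A))).
  move=> p q /pi_quotP/ideal_genP[c]; rewrite big_ord0 => /eqP.
  by rewrite subr_eq0 => /eqP.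
have [|f fE] := @linear_ofP A A^o (quot_mod (Nil A)) (\pi_(quot_mod (Nil A))).
  move=> b p q; rewrite pi_quotD; congr (_ + _).
  exact/esym/pi_quot_scale.
have f_inj : injective f by move=> p q; rewrite !fE => /piK.
have [|h hE] := @linear_factor _ _ _ _ f idfun f_inj.
  by move=> x; have [p <-] := pi_surj x; exists p; rewrite fE.
apply: (@proj_dim_le_iso _ 0 _ _ f h) (@projective_regular A) => // p.
by apply: f_inj; rewrite hE.
Qed.

End QuotientMaps.

(** * Edge ideals enlarged by variables, and their colon ideals *)

Section EdgeIdeals.
Variables (K : fieldType) (n : nat).
Implicit Types (p q : {mpoly K[n]}) (m k : 'X_{1..n}) (i j v : 'I_n).
Implicit Types (H : sgraph n) (U W X : {set 'I_n}).

Lemma mem_monomial_ideal (ks : seq 'X_{1..n}) p :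
  p \in ideal_gen [seq 'X_[k] | k <- ks]
    <-> supported (fun m => has (fun k => k <= m)%MM ks) p.
Proof.
split=> [/ideal_genP[c ->]|pS].
  apply: big_ind => [m||i _ m]; first by rewrite mcoeff0 eqxx.
    exact: supportedD.
  have i_lt : (i < size ks)%N by rewrite -(size_map (fun k => 'X_[K, k])).
  rewrite (nth_map 0%MM) // -mcoeff_msupp (perm_mem (msuppMX _ _)).
  case/mapP => m' _ ->; apply/hasP; exists (nth 0%MM ks i); first exact: mem_nth.
  exact: lem_addr.
rewrite [p]mpolyE big_seq; apply: rpred_sum => m.
rewrite mcoeff_msupp => /pS/hasP[k k_ks km].
rewrite -mul_mpolyC -(submK km) mpolyXD mulrA; apply: ideal_genM.
by apply: mem_ideal_gen; apply: map_f.
Qed.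

Definition edge_var_gens H U : seq {mpoly K[n]} :=
  edge_gens K H ++ [seq 'X_i | i <- enum U].

Definition edge_var_monomial H U m : bool :=
  [exists i in U, 0 < m i]%N
  || [exists i, exists j, [&& H i j, 0 < m i & 0 < m j]]%N.

Lemma mem_edge_var_ideal H U p :
  p \in ideal_gen (edge_var_gens H U) <-> supported (edge_var_monomial H U) p.
Proof.
pose ks := [seq (U_(e.1) + U_(e.2))%MM | e <- enum {: 'I_n * 'I_n} & H e.1 e.2]
  ++ [seq U_(i)%MM | i <- enum U].
have -> : edge_var_gens H U = [seq 'X_[k] | k <- ks].
  rewrite map_cat -!map_comp; congr (_ ++ _).
  by apply: eq_map => e; rewrite /= mpolyXD.
rewrite mem_monomial_ideal; suff kE m :
    has (fun k => k <= m)%MM ks = edge_var_monomial H U m.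
  by split=> pS m /pS; rewrite kE.
rewrite has_cat orbC !has_map; congr (_ || _).
  apply/hasP/exists_inP => [[i iU mi]|[i iU mi]]; exists i => //.
  - by rewrite mem_enum in iU.
  - by move: mi; rewrite /= mnm1_le.
  - by rewrite mem_enum.
  - by rewrite /= mnm1_le.
apply/hasP/existsP => [[[i j]]|[i /existsP[j /and3P[Hij mi mj]]]].
  rewrite mem_filter mem_enum andbT /= => Hij /mnm_lepP le_m.
  exists i; apply/existsP; exists j; rewrite Hij.
  have := le_m i; have := le_m j; rewrite !mnmDE !mnm1E !eqxx.
  by case: (m i) => [|?]; case: (m j) => [|?]; rewrite ?addnS ?addSn ?ltn0.
exists (i, j); first by rewrite mem_filter mem_enum andbT.
apply/mnm_lepP => l; rewrite mnmDE !mnm1E /=.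
case: eqP => [<-|_]; last by case: eqP => // <-.
case: eqP => [ji|//]; last by move: Hij; rewrite ji adj_irrefl.
Qed.

Definition nbrs H v := [set j | H v j].

(** An extra factor ['X_v] completes exactly the edges at [v], so each neighbour of [v] turns into a
    variable generator. *)
Lemma colon_monomial H U v m : v \notin U ->
  edge_var_monomial H U (m + U_(v)) = edge_var_monomial H (U :|: nbrs H v) m.
Proof.
move=> vU; apply/orP/orP.
- case=> [/exists_inP[i iU]|/existsP[i /existsP[j /and3P[Hij]]]].
    rewrite mnmDE mnm1E; case: eqP vU => [->|_ _]; first by rewrite iU.
    rewrite addn0 => mi; left; apply/exists_inP; exists i => //.
    by rewrite !inE iU.
  rewrite !mnmDE !mnm1E; have [vi|_] := eqVneq v i.
    have [vj|_ _] := eqVneq v j; first by move: Hij; rewrite -vi -vj adj_irrefl.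
    rewrite addn0 => mj; left; apply/exists_inP; exists j => //.
    by rewrite !inE vi Hij orbT.
  rewrite addn0 => mi; have [vj _|_] := eqVneq v j.
    left; apply/exists_inP; exists i => //.
    by rewrite !inE vj adj_sym Hij orbT.
  rewrite addn0 => mj; right; apply/existsP; exists i; apply/existsP; exists j.
  exact/and3P.
- case=> [/exists_inP[i]|/existsP[i /existsP[j /and3P[Hij mi mj]]]].
    rewrite !inE => /orP[iU|Hvi] mi.
      by left; apply/exists_inP; exists i; rewrite // mnmDE addn_gt0 mi.
    right; apply/existsP; exists v; apply/existsP; exists i.
    by rewrite Hvi !mnmDE mnm1E eqxx addn_gt0 orbT addn_gt0 mi.
  right; apply/existsP; exists i; apply/existsP; exists j.
  by rewrite Hij !mnmDE !addn_gt0 mi mj.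
Qed.

Definition ev_pdim_le d H U := proj_dim_le d (quot_mod (edge_var_gens H U)).

Lemma ev_colon_ses H U v : v \notin U ->
  exists (i : {linear quot_mod (edge_var_gens H (U :|: nbrs H v))
                      -> quot_mod (edge_var_gens H U)})
         (g : {linear quot_mod (edge_var_gens H U)
                      -> quot_mod (edge_var_gens H (v |: U))}), ses i g.
Proof.
move=> vU; apply: (colon_ses (a := 'X_v)) => [p|p||p].
- apply/idP/idP => /mem_edge_var_ideal pS; apply/mem_edge_var_ideal.
    by apply/supportedXM => m /pS; rewrite colon_monomial.
  by move/supportedXM: pS => pS m /pS; rewrite colon_monomial.
- move=> /mem_edge_var_ideal pS; apply/mem_edge_var_ideal => m /pS /orP[|Hm].
    case/exists_inP => i iU mi; apply/orP; left; apply/exists_inP; exists i => //.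
    by rewrite !inE iU orbT.
  by apply/orP; right.
- apply/mem_ideal_gen; rewrite mem_cat; apply/orP; right.
  by apply: map_f; rewrite mem_enum !inE eqxx.
- move=> /mem_edge_var_ideal pS.
  exists (\sum_(m <- msupp p | (0 < m v)%N) p@_m *: 'X_[(m - U_(v))%MM]).
  apply/mem_edge_var_ideal => m.
  have -> : 'X_v * (\sum_(m <- msupp p | (0 < m v)%N) p@_m *: 'X_[(m - U_(v))%MM])
      = \sum_(m <- msupp p | (0 < m v)%N) p@_m *: 'X_[m].
    rewrite mulr_sumr; apply: eq_bigr => k kv.
    by rewrite -scalerAr -mpolyXD addmC submK // mnm1_le.
  rewrite mcoeffB mcoeff_restrict; case: ifPn => [|mv]; first by rewrite subrr eqxx.
  rewrite subr0 => /pS/orP[/exists_inP[i]|Hm]; last by apply/orP; right.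
  rewrite !inE => /predU1P[->|iU] mi; first by rewrite mi in mv.
  by apply/orP; left; apply/exists_inP; exists i.
Qed.

Lemma ev_pdim_le_colon d H U v : v \notin U ->
  ev_pdim_le d H (U :|: nbrs H v) -> ev_pdim_le d H (v |: U) ->
  ev_pdim_le d H U.
Proof. by move=> /(ev_colon_ses H)[i [g ig]]; apply: proj_dim_le_extension ig. Qed.

(** Here the colon ideal is the ideal itself, so ['X_v] is a nonzerodivisor on the quotient and
    adding it costs at most one. *)
Lemma ev_pdim_le_isolated d H U v : v \notin U -> nbrs H v \subset U ->
  ev_pdim_le d H U -> ev_pdim_le d.+1 H (v |: U).
Proof.
move=> /(ev_colon_ses H)[i [g ig]] /setUidPl NU pdU.
by apply: (proj_dim_le_quotient ig) => //; rewrite NU.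
Qed.

(** Edges meeting [U] are multiples of variables already in the ideal. *)
Lemma ev_pdim_le_outside d H H' U :
  (forall i j, i \notin U -> j \notin U -> H i j = H' i j) ->
  ev_pdim_le d H U -> ev_pdim_le d H' U.
Proof.
move=> HH'; apply: quot_mod_eq_ideal => p.
have sub (G G' : sgraph n) m : (forall i j, i \notin U -> j \notin U -> G i j = G' i j) ->
    edge_var_monomial G U m -> edge_var_monomial G' U m.
  move=> GG' /orP[Um|]; first by apply/orP; left.
  case/existsP=> i /existsP[j /and3P[Gij mi mj]]; apply/orP.
  have [iU|iU] := boolP (i \in U); first by left; apply/exists_inP; exists i.
  have [jU|jU] := boolP (j \in U); first by left; apply/exists_inP; exists j.
  by right; apply/existsP; exists i; apply/existsP; exists j; rewrite -GG' // Gij mi.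
apply/idP/idP => /mem_edge_var_ideal pS; apply/mem_edge_var_ideal => m /pS.
  exact: sub.
by apply: sub => i j iU jU; rewrite HH'.
Qed.

Lemma ev_pdim_le_edgeless H U :
  (forall i j, H i j -> (i \in U) || (j \in U)) -> ev_pdim_le #|U| H U.
Proof.
have sym0 : ssrbool.symmetric (fun _ _ : 'I_n => false) by [].
have irr0 : irreflexive (fun _ _ : 'I_n => false) by [].
move=> cover; pose H0 := SGraph sym0 irr0.
(* Replace [H] by the graph without edges, then add the variables of [U] one at a time. *)
apply: (@ev_pdim_le_outside _ H0) => [i j iU jU|].
  by apply/esym/negbTE/negP => /cover; rewrite (negPf iU) (negPf jU).
have [d Ud] : exists d, #|U| = d by exists #|U|.
rewrite Ud; elim: d U Ud {cover} => [|d IHd] U Ud.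
  have -> : U = set0 by apply: cards0_eq.
  rewrite /ev_pdim_le /edge_var_gens enum_set0 cats0 /edge_gens.
  by rewrite (eq_filter (a2 := pred0)) // filter_pred0;
    apply: (@quot_mod_nil {mpoly K[n]}).
have /card_gt0P[v vU] : (0 < #|U|)%N by rewrite Ud.
rewrite -(setD1K vU); apply: ev_pdim_le_isolated; first by rewrite !inE eqxx.
  by apply/subsetP => j; rewrite inE.
by apply: IHd; move: Ud; rewrite (cardsD1 v) vU => -[].
Qed.

End EdgeIdeals.

(** * The Koszul lower bound for edge ideals *)

Section LowerBound.
Variables (K : fieldType) (n : nat).

Lemma edge_var_gens0 (H : sgraph n) : edge_var_gens K H set0 = edge_gens K H.
Proof. by rewrite /edge_var_gens enum_set0 cats0. Qed.

Lemma scale_pi (gs : seq {mpoly K[n]}) a p :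
  a *: \pi_(quot_mod gs) p = \pi_(quot_mod gs) (a * p).
Proof. exact: pi_quot_scale. Qed.

(* The cocycle is [x_i |-> x_i * \prod_(w in W) x_w] on [X] and [0] off [X]. *)
Lemma pdim_lower_bound d (H : sgraph n) (W X : {set 'I_n}) a b :
    proj_dim_le d (quot_mod (edge_gens K H)) ->
    a \in X -> a \notin W -> b \notin X -> b \notin W ->
    independent H (a |: W) -> independent H (b |: W) ->
    {in X & ~: (X :|: W), forall i j, H i j || [exists w in W, H w j]} ->
  (n <= d + #|W| + 1)%N.
Proof.
move=> pdH aX aW bX bW indepa indepb XW; rewrite leqNgt; apply/negP => ltdn.
pose mW : 'X_{1..n} := [multinom (i \in W : nat) | i < n].
pose mu : {mpoly K[n]} := 'X_[mW].
pose ys : seq {mpoly K[n]} := [seq 'X_i | i <- enum (~: W)].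
pose gs := edge_gens K H.
pose m y : quot_mod gs :=
  if y \in [seq 'X_i | i <- enum X] then \pi_(quot_mod gs) (y * mu) else 0.
have X_inj : injective (fun i : 'I_n => 'X_i : {mpoly K[n]}).
  move=> i j /(congr1 (mcoeff U_(i))); rewrite !mcoeffXU eqxx.
  by case: eqP => // _ /eqP; rewrite oner_eq0.
have mE i : m 'X_i = if i \in X then \pi_(quot_mod gs) ('X_i * mu) else 0.
  by rewrite /m (mem_map X_inj) mem_enum.
(* The product [x_j x_i mu] contains an edge, either between [i] and [j] or from [W] to [j]; this is
   the cocycle condition. *)
have dead i j : i \in X -> j \notin X -> j \notin W ->
    \pi_(quot_mod gs) ('X_j * ('X_i * mu)) = 0.
  move=> iX jX jW; apply/pi_eq0; rewrite /gs -edge_var_gens0.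
  apply/mem_edge_var_ideal/supportedXM/supportedXM => k.
  rewrite mcoeffX; have [<- _|_] := eqVneq mW k; last by rewrite eqxx.
  have /orP[Hij|/exists_inP[w wW Hwj]] : H i j || [exists w in W, H w j].
  - by apply: XW; rewrite // !inE negb_or jX.
  - apply/orP; right; apply/existsP; exists i; apply/existsP; exists j.
    by rewrite Hij !mnmDE !mnm1E !eqxx !addn1.
  - apply/orP; right; apply/existsP; exists w; apply/existsP; exists j.
    by rewrite Hwj !mnmDE !mnm1E !eqxx mnmE wW /= !addn1.
(* Conversely, [x_l mu] is nonzero in the quotient when [l |: W] is independent. *)
have mono l : independent H (l |: W) ->
    ~~ edge_var_monomial H set0 (mW + U_(l)).
  move=> /forall_inP indep; apply/orP => -[/exists_inP[i]|]; first by rewrite inE.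
  case/existsP => i /existsP[j /and3P[Hij mi mj]].
  have lW k : (0 < (mW + U_(l))%MM k)%N -> k \in l |: W.
    by rewrite mnmDE mnm1E mnmE !inE [k == l]eq_sym; case: (k \in W); case: eqP.
  by have /forall_inP/(_ j (lW j mj)) := indep i (lW i mi); rewrite Hij.
(* The variables outside [W] number [n - #|W|], which is at least [d + 2] by the assumption for
   contradiction. *)
have [||||m' m'E] := @koszul1_vanishing _ d [::] ys _ m pdH.
- by [].
- move=> P projP; apply: regular_projective projP.
  rewrite -[catrev _ _]/(rev ys) -map_rev; apply: regular_vars.
  by rewrite rev_uniq enum_uniq.
- rewrite size_map -cardE -(ltn_add2r #|W|) [X in (_ < X)%N]addnC cardsC card_ord; lia.
- move=> _ _ /mapP[i iW ->] /mapP[j jW ->] /=.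
  rewrite !mem_enum !inE in iW jW; rewrite !mE.
  case: ifPn => jX; case: ifPn => iX; rewrite ?scaler0 ?scale_pi ?subr0 ?sub0r.
  + by rewrite mulrCA subrr.
  + exact: dead.
  + by rewrite dead // oppr0.
  + by [].
have [q qE] := pi_surj m'; rewrite -{}qE in m'E.
(* The coefficient of [x_c mu] determines that of [mu] in [q]: it would be 1 by [a] in [X] and 0 by
   [b] outside [X]. *)
have inI c (e : bool) : c \notin W -> m 'X_c = \pi_(quot_mod gs) ('X_c * (e%:R * mu)) ->
    independent H (c |: W) -> q@_mW = e%:R.
  move=> cW mcE indep; have := m'E 'X_c; rewrite (mem_map X_inj) mem_enum inE cW.
  move=> /(_ isT) /= /eqP; rewrite subr_eq0 mcE scale_pi => /eqP/pi_quotP.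
  rewrite -mulrBr /gs -edge_var_gens0 => /mem_edge_var_ideal/supportedXM/(_ mW).
  rewrite mcoeffB -mpolyC_nat mcoeffCM mcoeffX eqxx mulr1 (negPf (mono _ indep)).
  by case: eqVneq => [/eqP|_ /(_ isT)] //; rewrite subr_eq0 => /eqP.
have := inI a true aW; rewrite mE aX mul1r => /(_ erefl indepa) qa.
have := inI b false bW; rewrite mE (negPf bX) mul0r mulr0 qa => /(_ _ indepb)/eqP.
by rewrite oner_eq0 => qb; suff: false by []; apply: qb; apply/esym/pi_eq0/rpred0.
Qed.

End LowerBound.

(** * Upper bounds *)

Section UpperBounds.
Variables (K : fieldType) (N : nat).
Implicit Types (U : {set 'I_N}) (m d : nat).

(** The path on the first [m] vertices, the others being isolated; all initial segments thus share
    one polynomial ring. *)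
Definition initial_path_adj m : rel 'I_N :=
  fun i j => [&& i < m, j < m & (i.+1 == j :> nat) || (j.+1 == i :> nat)]%N.

Fact initial_path_adj_sym m : ssrbool.symmetric (initial_path_adj m).
Proof. by move=> i j; rewrite /initial_path_adj andbCA orbC. Qed.

Fact initial_path_adj_irrefl m : irreflexive (initial_path_adj m).
Proof. by move=> i; rewrite /initial_path_adj; lia. Qed.

Definition initial_path m : sgraph N :=
  SGraph (@initial_path_adj_sym m) (@initial_path_adj_irrefl m).

Lemma ev_pdim_leW d d' (H H' : sgraph N) U U' :
  ev_pdim_le K d H U -> U = U' -> (d <= d')%N ->
  (forall i j : 'I_N, i \notin U' -> j \notin U' -> H i j = H' i j) ->
  ev_pdim_le K d' H' U'.
Proof.
move=> pdU <- dd' /ev_pdim_le_outside; apply.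
exact: proj_dim_leW pdU.
Qed.

(** Branch at the last vertex but one, [v]. The colon removes [v] and its neighbours, three vertices
    for two variables; adding [x_v] removes [v] and the now isolated last vertex for one
    variable. *)
Lemma initial_path_upper_bound m U :
  (m <= N)%N -> (forall i, i \in U -> (m <= i)%N) ->
  ev_pdim_le K (#|U| + (2 * m) %/ 3) (initial_path m) U.
Proof.
have card1 (w : 'I_N) (V : {set 'I_N}) : (#|w |: V| <= #|V|.+1)%N.
  by rewrite cardsU1; case: (w \in V).
elim/ltn_ind: m U => -[|[|k]] IHm U mN Um.
- rewrite addn0; apply: ev_pdim_le_edgeless => i j /=.
  by rewrite /initial_path_adj ltn0.
- rewrite addn0; apply: ev_pdim_le_edgeless => i j /=.
  by rewrite /initial_path_adj; lia.
have k_lt : (k < N)%N by lia.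
have k1_lt : (k.+1 < N)%N by lia.
pose v := Ordinal k_lt; pose v1 := Ordinal k1_lt.
have vU : v \notin U by apply/negP => /Um /=; lia.
apply: (@ev_pdim_le_colon _ _ _ _ _ v) => //.
  case: k => [|k] in IHm mN Um k_lt k1_lt v v1 vU *.
    (* For [m = 2] the vertex [v] is the first one and has a single neighbour. *)
    apply: (@ev_pdim_leW #|v1 |: U| _ (initial_path 0)).
    - apply: (@ev_pdim_leW (#|v1 |: U| + (2 * 0) %/ 3) _ (initial_path 0)).
      + by apply: IHm => // i; rewrite !inE => /predU1P[->|/Um] //=; lia.
      + by [].
      + by lia.
      + by [].
    - apply/setP => x; rewrite !inE /= /initial_path_adj -val_eqE /=.
      by case: (x \in U); lia.
    - have := card1 v1 U; move: #|v1 |: U| #|U| => x u; lia.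
    - by move=> i j; rewrite !inE /= /initial_path_adj /=; lia.
  have k0_lt : (k < N)%N by lia.
  pose v0 := Ordinal k0_lt.
  apply: (@ev_pdim_leW _ _ (initial_path k) _ (v0 |: (v1 |: U))).
  - apply: (IHm k) => [||i]; [lia..|].
    by rewrite !inE -!val_eqE /= => /or3P[/eqP->|/eqP->|/Um] //; lia.
  - apply/setP => x; rewrite !inE /= /initial_path_adj -!val_eqE /=.
    by case: (x \in U); lia.
  - have := card1 v1 U; have := card1 v0 (v1 |: U).
    move: #|v0 |: _| #|v1 |: U| #|U| => x y u; lia.
  - by move=> i j; rewrite !inE /= /initial_path_adj /=; lia.
apply: (@ev_pdim_leW _ _ (initial_path k) _ (v |: U)).
- apply: (IHm k) => [||i]; [lia..|].
  by rewrite !inE -!val_eqE /= => /predU1P[->|/Um] //; lia.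
- by [].
- by rewrite cardsU1 vU; lia.
- by move=> i j; rewrite !inE -!val_eqE /= /initial_path_adj /=; lia.
Qed.

(* Each element of [c] and each gap of length two costs one; consecutive elements
   of [c] are separated by a gap, whence two per three vertices. *)
Lemma dominating_upper_bound (n : nat) (c : pred nat) m U :
    (n <= N)%N -> (forall i, c i -> (i < n)%N) ->
    (forall i, c i -> ~~ c i.+1) ->
    (forall i, (i.+2 < n)%N -> [|| c i, c i.+1 | c i.+2]) ->
    (m <= n)%N -> (forall i, i \in U -> (m <= i)%N) ->
  ev_pdim_le K (#|U| + (2 * m + ~~ c m) %/ 3) (initial_path m)
    ([set i : 'I_N | (i < m)%N && c i] :|: U).
Proof.
move=> nN c_lt c_indep c_dom; elim/ltn_ind: m U => -[|k] IHm U mn Um.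
  apply: (@ev_pdim_leW #|U| _ (initial_path 0) _ U).
  - by apply: ev_pdim_le_edgeless => i j; rewrite /= /initial_path_adj ltn0.
  - by apply/setP => x; rewrite !inE ltn0.
  - by lia.
  - by [].
have k_lt : (k < N)%N by lia.
pose v := Ordinal k_lt.
have vU : v \notin U by apply/negP => /Um /=; lia.
have cardvU : #|v |: U| = #|U|.+1 by rewrite cardsU1 vU.
(* A vertex of [c] costs one variable, paid for by the summand [~~ c m]: it is 1 at [k.+1] and 0 at
   [k]. *)
have [ck|nck] := boolP (c k).
  apply: (@ev_pdim_leW _ _ (initial_path k) _ _ _ (IHm k _ (v |: U) _ _)).
  - by [].
  - by lia.
  - by move=> i; rewrite !inE => /predU1P[->|/Um] //=; lia.
  - apply/setP => x; rewrite !inE -val_eqE /=.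
    by case: (ltngtP x k) => [||->]; rewrite ?ck ?ltnSn; case: (x \in U) => //=; lia.
  - by rewrite cardvU ck (negPf (c_indep _ ck)); move: #|U| => u; lia.
  - have ne (x : 'I_N) : x \notin [set i : 'I_N | (i < k.+1)%N && c i] :|: U ->
        (x != k :> nat)%N.
      by apply: contra => /eqP xk; rewrite !inE xk ck ltnSn.
    by move=> i j /ne ik /ne jk; rewrite /= /initial_path_adj; lia.
(* When [k] is 0 or its predecessor is in [c], it is isolated in the remaining segment and costs
   nothing. *)
have [k_covered|/norP[k_pos nck1]] := boolP ((k == 0) || c k.-1)%N.
  apply: (@ev_pdim_leW _ _ (initial_path k) _ _ _ (IHm k _ U _ _)).
  - by [].
  - by lia.
  - by move=> i /Um; lia.
  - apply/setP => x; rewrite !inE.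
    by case: (ltngtP x k) => [||->]; rewrite ?(negPf nck) ?andbF;
      case: (x \in U) => //=; lia.
  - by rewrite nck; move: #|U| => u; lia.
  - have ne (x : 'I_N) : x \notin [set i : 'I_N | (i < k.+1)%N && c i] :|: U ->
        (k == 0) || (x != k.-1 :> nat)%N.
      case/orP: k_covered => [->|ck1] //; rewrite orbC; apply: contraNT.
      by rewrite negb_or negbK => /andP[/eqP xk _]; rewrite !inE xk ck1 andbT; lia.
    by move=> i j /ne ik /ne jk; rewrite /= /initial_path_adj; lia.
case: k => // l in IHm mn Um k_lt v vU cardvU nck k_pos nck1 *.
have l_lt : (l < N)%N by lia.
pose w := Ordinal l_lt.
have wU : w \notin U by apply/negP => /Um /=; lia.
have cardwU : #|w |: U| = #|U|.+1 by rewrite cardsU1 wU.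
rewrite /= in nck1.
(* The gap is [l, l.+1]. Both branches at [w = l] cost one variable and leave the first [l]
   vertices; in the colon branch the neighbour below [l], if any, is already in [c]. *)
apply: (@ev_pdim_le_colon _ _ _ _ _ w).
- by rewrite !inE /= (negPf nck1) andbF.
- apply: (@ev_pdim_leW _ _ (initial_path l) _ _ _ (IHm l _ (v |: U) _ _)).
  + by lia.
  + by lia.
  + by move=> i; rewrite !inE => /predU1P[->|/Um] //=; lia.
  + apply/setP => x; rewrite !inE /= /initial_path_adj -!val_eqE /=.
    have [xl|xl] := eqVneq (x : nat) l.
      by rewrite xl (negPf nck1); case: (x \in U); lia.
    have [xl1|xl1] := eqVneq (x : nat) l.+1.
      by rewrite xl1; case: (x \in U); lia.
    have [xl2|xl2] := eqVneq (x : nat).+1 l; last by case: (x \in U); case: (c x); lia.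
    have := c_dom (val x); rewrite xl2 (negPf nck1) (negPf nck) !orbF.
    by move=> ->; [case: (x \in U); lia | lia].
  + by rewrite cardvU nck1; move: #|U| => u; lia.
  + move=> i j; rewrite !inE /= /initial_path_adj /=.
    by rewrite !negb_or !negb_and; lia.
- apply: (@ev_pdim_leW _ _ (initial_path l) _ _ _ (IHm l _ (w |: U) _ _)).
  + by lia.
  + by lia.
  + by move=> i; rewrite !inE => /predU1P[->|/Um] //=; lia.
  + apply/setP => x; rewrite !inE -!val_eqE /=.
    have [xl|xl] := eqVneq (x : nat) l; first by rewrite ?orbT.
    have [xl1|xl1] := eqVneq (x : nat) l.+1.
      by rewrite xl1 (negPf nck); case: (x \in U); lia.
    by case: (x \in U); case: (c x); lia.
  + by rewrite cardwU nck1; move: #|U| => u; lia.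
  + move=> i j; rewrite !inE -!val_eqE /= /initial_path_adj !negb_or.
    by move=> /andP[il _] /andP[jl _]; lia.
Qed.
End UpperBounds.

(** * Lower bounds *)

Section LowerBoundsPath.
Variables (K : fieldType) (N : nat).
Implicit Types (H : sgraph N) (W : {set 'I_N}).

(** Apply [pdim_lower_bound] to [W :\ w] with [X] reduced to [w]. The private neighbour [b] of [w]
    serves as the vertex outside [X]. *)
Lemma dominating_lower_bound d H W w b :
    proj_dim_le d (quot_mod (edge_gens K H)) -> w \in W -> independent H W ->
    (forall j, j \notin W -> [exists i in W, H i j]) ->
    b \notin W -> (forall i, i \in W -> H i b -> i = w) ->
  (N <= d + #|W|)%N.
Proof.
move=> pdH wW indepW domW bW b_priv.
rewrite (cardsD1 w) wW addnCA add1n -addn1.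
have bNw : b != w by apply: contraNneq bW => ->.
apply: (@pdim_lower_bound _ _ _ _ _ [set w] w b pdH).
- by rewrite inE.
- by rewrite !inE eqxx.
- by rewrite inE.
- by rewrite !inE negb_and bW orbT.
- by rewrite setD1K.
- apply/forall_inP => i; rewrite !inE => iW; apply/forall_inP => j; rewrite !inE => jW.
  apply/negP => Hij; case/predU1P: iW Hij => [->|/andP[iw iW]].
    case/predU1P: jW => [->|/andP[jw jW]]; first by rewrite adj_irrefl.
    by rewrite adj_sym => /(b_priv _ jW)/eqP; rewrite (negPf jw).
  case/predU1P: jW => [->|/andP[jw jW] Hij].
    by move=> /(b_priv _ iW)/eqP; rewrite (negPf iw).
  by move/forall_inP/(_ i iW)/forall_inP/(_ j jW)/negP: indepW; apply.
- move=> i j; rewrite !inE => /eqP-> /norP[jw]; rewrite negb_and negbK (negPf jw) /=.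
  move=> /domW/exists_inP[k kW Hkj].
  have [kw|kw] := eqVneq k w; first by rewrite -kw Hkj.
  by apply/orP; right; apply/exists_inP; exists k; rewrite // !inE kw.
Qed.

Lemma card_thirds n W : (forall i, i \in W -> (i < n)%N) ->
  (forall i j : 'I_N, i \in W -> j \in W -> (i %/ 3 = j %/ 3)%N -> i = j) ->
  (#|W| <= (n + 2) %/ 3)%N.
Proof.
move=> Wn W_inj; rewrite cardE -(size_map (fun i : 'I_N => i %/ 3)%N).
rewrite -[X in (_ <= X)%N](size_iota 0); apply: uniq_leq_size.
  rewrite map_inj_in_uniq ?enum_uniq // => i j.
  by rewrite !mem_enum; apply: W_inj.
move=> _ /mapP[i + ->]; rewrite mem_enum mem_iota => /Wn.
lia.
Qed.

Definition path_on n H := forall i j : 'I_N, (i < n)%N -> (j < n)%N ->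
  H i j = (i.+1 == j :> nat) || (j.+1 == i :> nat).

Lemma path_independent n H W : path_on n H -> (forall i, i \in W -> (i < n)%N) ->
  (forall i j : 'I_N, i \in W -> j \in W -> (i.+1 != j)%N) -> independent H W.
Proof.
move=> Hn Wn Wnadj; apply/forall_inP => i iW; apply/forall_inP => j jW.
by rewrite Hn ?Wn // negb_or !Wnadj.
Qed.

(** Indices start at 0, so these are [x_2, x_5, ...], one vertex in each block of three; if [n] is 1
    modulo 3, the last vertex is a block by itself. *)
Definition ones_mod3 n : {set 'I_N} :=
  [set i : 'I_N | (i < n) && ((i %% 3 == 1) || (i.+1 == n) && (n %% 3 == 1))]%N.

Lemma card_ones_mod3 n : (#|ones_mod3 n| <= (n + 2) %/ 3)%N.
Proof.
apply: card_thirds => [i|i j]; rewrite !inE; first by case/andP.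
by move=> iW jW ij; apply/val_inj => /=; lia.
Qed.

Lemma ones_mod3_independent n H : path_on n H -> independent H (ones_mod3 n).
Proof.
move=> Hn; apply: (path_independent Hn) => [i|i j]; rewrite !inE; first by case/andP.
lia.
Qed.

(** The dominating vertex lies in the same block as [j], which locates [j] in the exceptional case
    for the suspension. *)
Lemma ones_mod3_dominates n H : path_on n H -> (n <= N)%N -> forall j : 'I_N,
  (j < n)%N -> j \notin ones_mod3 n ->
  exists2 i : 'I_N, i \in ones_mod3 n & H i j /\ (i %/ 3 = j %/ 3)%N.
Proof.
move=> Hn nN j jn; rewrite inE jn /= => jW.
have [j0|j0] := eqVneq (j %% 3)%N 0%N.
  have j1_lt : (j.+1 < N)%N by lia.
  exists (Ordinal j1_lt); first by rewrite inE /=; lia.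
  by rewrite Hn //=; lia.
have j1_lt : (j.-1 < N)%N by lia.
exists (Ordinal j1_lt); first by rewrite inE /=; lia.
by rewrite Hn //=; lia.
Qed.

(** Vertex 0 is a private neighbour of vertex 1. The case [N = n] serves the path, [N = n.+1] the
    suspension. *)
Lemma ones_mod3_lower_bound d n H : (1 < n <= N)%N -> path_on n H ->
    (forall j : 'I_N, (n <= j)%N -> [exists i in ones_mod3 n, H i j]) ->
    proj_dim_le d (quot_mod (edge_gens K H)) ->
  (N <= d + (n + 2) %/ 3)%N.
Proof.
move=> /andP[n1 nN] Hn dom pdH.
have N0 : (0 < N)%N by lia.
have N1 : (1 < N)%N by lia.
apply: leq_trans (_ : _ <= d + #|ones_mod3 n|)%N _; last first.
  by rewrite leq_add2l card_ones_mod3.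
apply: (@dominating_lower_bound d H _ (Ordinal N1) (Ordinal N0)) => //.
- by rewrite inE /=; lia.
- exact: ones_mod3_independent.
- move=> j jW; have [jn|] := ltnP j n; last exact: dom.
  have [i iW [Hij _]] := ones_mod3_dominates Hn nN jn jW.
  by apply/exists_inP; exists i.
- by rewrite inE /=; lia.
- move=> i; rewrite inE => /andP[i_lt iW]; rewrite Hn //=; last by lia.
  by move=> i01; apply/val_inj => /=; lia.
Qed.

End LowerBoundsPath.

(** * The suspension of a path over a maximal independent set *)

Section Suspension.
Variables (K : fieldType) (n : nat) (C : {set 'I_n}).

(** Membership in [C] for arbitrary natural numbers, false from [n] on, so that shifted indices need
    no bound. *)
Let c (k : nat) : bool := [exists i in C, i == k :> nat].

Lemma suspended_lt k : c k -> (k < n)%N.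
Proof. by case/exists_inP => i _ /eqP <-. Qed.

Lemma suspendedE (i : 'I_n) : c i = (i \in C).
Proof.
by apply/exists_inP/idP => [[j jC /eqP/val_inj <-]|iC] //; exists i.
Qed.

Lemma suspended_last : c n = false.
Proof. by apply/negbTE/negP => /suspended_lt; rewrite ltnn. Qed.

Lemma suspension_path_adjE u v :
  suspension (path_graph n) C u v =
  [|| initial_path n.+1 n u v, (u == n :> nat) && c v | (v == n :> nat) && c u].
Proof.
rewrite /= /suspension_adj /initial_path_adj.
case: (unliftP ord_max u) => [i|] ->; case: (unliftP ord_max v) => [j|] ->;
  rewrite ?lift_max /= ?suspendedE ?ltnn ?eqxx ?suspended_last ?andbF ?orbF //=.
by rewrite !ltn_ord (ltn_eqF (ltn_ord i)) (ltn_eqF (ltn_ord j)) !orbF.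
Qed.

Hypothesis maxC : maxset (independent (path_graph n)) C.

Lemma suspended_indep k : c k -> ~~ c k.+1.
Proof.
case/exists_inP => i iC /eqP ik; apply/exists_inP => -[j jC /eqP jk].
have [/forall_inP/(_ i iC)/forall_inP/(_ j jC) /= + _] := maxsetP maxC.
by rewrite /path_adj ik jk eqxx.
Qed.

Lemma suspended_max k : (k < n)%N -> [|| c k, c k.+1 | (0 < k)%N && c k.-1].
Proof.
move=> kn; pose i := Ordinal kn.
have c_val (j : 'I_n) : j \in C -> c j by rewrite suspendedE.
have [indepC maxC'] := maxsetP maxC.
have [//|nck] := boolP (c k); have [//|nck1] := boolP (c k.+1).
apply/negPn/negP => nck2.
have i_adj j : j \in C -> ~~ path_adj i j.
  move=> /c_val cj; apply/negP => /orP[/eqP kj|/eqP jk].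
    by move: nck1; rewrite [k.+1]kj cj.
  by move: nck2; rewrite -[k]/(nat_of_ord i) -jk /= cj.
have := maxC' (i |: C); rewrite subsetUr => /(_ _ isT) eqC.
have : i \in C.
  rewrite -eqC ?inE ?eqxx //; apply/forall_inP => x; rewrite !inE => xC.
  apply/forall_inP => y; rewrite !inE => yC.
  case/predU1P: xC => [->|xC]; case/predU1P: yC => [->|yC]; rewrite ?adj_irrefl //.
  - exact: i_adj.
  - by rewrite adj_sym; apply: i_adj.
  - by move/forall_inP/(_ x xC)/forall_inP/(_ y yC): indepC.
by rewrite -suspendedE; apply/negP.
Qed.

Hypothesis n_gt0 : (0 < n)%N.

Lemma suspension_upper_bound :
  proj_dim_le ((2 * n) %/ 3).+1
    (quot_mod (edge_gens K (suspension (path_graph n) C))).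
Proof.
rewrite -edge_var_gens0 -/(ev_pdim_le _ _ _ _).
apply: (@ev_pdim_le_colon _ _ _ _ _ ord_max); first by rewrite inE.
  (* Colon branch at [z]: since [c n] is false, the bound is the floor of [(2n + 1)/3]. *)
  apply: (@ev_pdim_leW K n.+1 (#|set0 : {set 'I_n.+1}| + (2 * n + ~~ c n) %/ 3) _
    (initial_path _ n) _ ([set i : 'I_n.+1 | (i < n)%N && c i] :|: set0)).
  - apply: (@dominating_upper_bound K n.+1 n) => //.
    + exact: suspended_lt.
    + exact: suspended_indep.
    + by move=> k kn; case/or3P: (suspended_max (ltnW kn)) => [->|->|/= ->]; rewrite ?orbT.
    + by move=> i; rewrite inE.
  - apply/setP => x; rewrite setU0 set0U inE [RHS]inE suspension_path_adjE.
    rewrite /= /initial_path_adj ltnn eqxx suspended_last andbF orbF /=.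
    by apply/andP/idP => [[]//|cx]; split=> //; apply: suspended_lt.
  - by rewrite cards0; lia.
  - move=> i j; rewrite set0U !inE => iC jC; rewrite suspension_path_adjE.
    have nc (x : 'I_n.+1) : ~~ suspension (path_graph n) C ord_max x -> c x = false.
      by apply: contraNF => cx; rewrite suspension_path_adjE eqxx cx orbT.
    by rewrite (nc _ iC) (nc _ jC) !andbF !orbF.
apply: (@ev_pdim_leW K n.+1 (#|[set ord_max : 'I_n.+1]| + (2 * n) %/ 3) _
    (initial_path _ n) _ [set ord_max]).
- by apply: initial_path_upper_bound => // i; rewrite inE => /eqP->.
- by rewrite setU0.
- by rewrite cards1 add1n.
- move=> i j; rewrite setU0 !inE -!val_eqE => iz jz.
  by rewrite suspension_path_adjE (negPf iz) (negPf jz) !orbF.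
Qed.

Lemma suspension_path_on : path_on n (suspension (path_graph n) C).
Proof.
move=> i j i_lt j_lt; rewrite suspension_path_adjE /= /initial_path_adj i_lt j_lt.
by rewrite (ltn_eqF i_lt) (ltn_eqF j_lt) !orbF.
Qed.

(** Otherwise maximality forces all multiples of 3 below [n] into [C], each one excluding the index
    two above it. Then the last vertex [n - 1] is neither in [C] nor adjacent to [C]. *)
Lemma suspended_gap : (n %% 3 = 0)%N -> (forall k, (k %% 3 = 1)%N -> ~~ c k) ->
  exists k, [&& (k %% 3 == 0)%N, c k & c k.+2].
Proof.
move=> n3 no_c; apply: contrapT => no_gap.
have gap k : (k %% 3 = 0)%N -> c k -> ~~ c k.+2.
  move=> k3 ck; apply/negP => ck2; apply: no_gap; exists k.
  by rewrite k3 ck ck2.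
have c0 : c 0%N.
  by have := suspended_max n_gt0; rewrite (negPf (no_c 1%N _)) // !orbF.
have all_c k : (3 * k < n)%N -> c (3 * k)%N.
  elim: k => [|k IHk] kn; first by rewrite muln0.
  have ck : c (3 * k)%N by apply: IHk; lia.
  have := suspended_max kn; rewrite (_ : (3 * k.+1 = (3 * k).+3)%N); last by lia.
  rewrite /= (negPf (gap _ _ ck)) ?(negPf (no_c _.+4 _)) ?orbF //; lia.
pose k := (3 * (n %/ 3).-1)%N.
have ck : c k by apply: all_c; lia.
have kn : n = k.+3 by rewrite /k; lia.
have k3 : (k %% 3 = 0)%N by rewrite /k; lia.
have := @suspended_max k.+2; rewrite {1}kn ltnS leqnn => /(_ isT).
rewrite -kn suspended_last (negPf (gap k k3 ck)) /=.
by rewrite (negPf (no_c k.+1 _)) //; lia.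
Qed.

Lemma suspension_lower_bound d :
  proj_dim_le d (quot_mod (edge_gens K (suspension (path_graph n) C))) ->
  ((2 * n) %/ 3 < d)%N.
Proof.
set G := suspension _ _ => pdG.
have Gn : path_on n G := suspension_path_on.
have z_eq (j : 'I_n.+1) : (n <= j)%N -> j = n :> nat by have := ltn_ord j; lia.
have Gz (j i : 'I_n.+1) : (n <= j)%N -> G i j = c i.
  move=> /z_eq jn; rewrite /G suspension_path_adjE jn eqxx suspended_last andbF.
  by rewrite /= /initial_path_adj jn ltnn andbF.
have o0 : (0 < n.+1)%N by [].
have o1 : (1 < n.+1)%N by [].
have [/andP[c0 n3]|not0] := boolP (c 0%N && (n %% 3 != 0)%N).
  (* The multiples of 3 dominate the path because 3 does not divide [n], and they dominate [z]
     through vertex 0 in [C]. *)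
  pose W : {set 'I_n.+1} := [set i : 'I_n.+1 | (i < n)%N && (i %% 3 == 0)%N].
  suff : (n.+1 <= d + #|W|)%N.
    suff : (#|W| <= (n + 2) %/ 3)%N by move: #|W| => W'; lia.
    apply: card_thirds => [i|i j]; rewrite !inE; first by case/andP.
    by move=> iW jW ij; apply/val_inj => /=; lia.
  apply: (@dominating_lower_bound K n.+1 d G W (Ordinal o0) (Ordinal o1) pdG).
  - by rewrite inE /=; lia.
  - apply: (path_independent Gn) => [i|i j]; rewrite !inE; first by case/andP.
    lia.
  - move=> j jW; apply/exists_inP; have [jn|jn] := ltnP j n; last first.
      by exists (Ordinal o0); rewrite ?Gz // inE /=; lia.
    rewrite inE jn /= in jW; have [j1|j1] := eqVneq (j %% 3)%N 1%N.
      have i_lt : (j.-1 < n.+1)%N by lia.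
      exists (Ordinal i_lt); first by rewrite inE /=; lia.
      by rewrite Gn //=; lia.
    have i_lt : (j.+1 < n.+1)%N by lia.
    exists (Ordinal i_lt); first by rewrite inE /=; lia.
    by rewrite Gn //=; lia.
  - by rewrite inE /=; lia.
  (* The private neighbour of vertex 0 is index 1, which is [z] itself when [n = 1]. *)
  - move=> i; rewrite inE => /andP[i_lt i3] Gi; apply/val_inj => /=.
    have [n1|n1] := leqP n 1; first by lia.
    by move: Gi; rewrite Gn //=; lia.
have c01 : c 0%N || c 1%N by have := suspended_max n_gt0; rewrite /= orbF.
have n1 : (1 < n)%N.
  case/orP: c01 => [c0|/suspended_lt //]; move: not0; rewrite c0; lia.
have [/exists_inP[w wW cw]|/exists_inPn no_c] :=
    boolP [exists i in ones_mod3 n.+1 n, c i].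
  (* A vertex of [ones_mod3] in [C] makes this set dominate [z] as well. *)
  suff : (n.+1 <= d + (n + 2) %/ 3)%N by lia.
  apply: (ones_mod3_lower_bound _ Gn _ pdG); first by rewrite n1 /=.
  by move=> j nj; apply/exists_inP; exists w; rewrite // Gz.
have no_c1 k : (k %% 3 = 1)%N -> ~~ c k.
  move=> k1; apply/negP => ck; have kn := suspended_lt ck.
  have k_lt : (k < n.+1)%N by lia.
  by have := no_c (Ordinal k_lt); rewrite inE /= kn k1 ck => /(_ isT).
have n3 : (n %% 3 = 0)%N.
  by move: c01 not0; rewrite (negPf (no_c1 1%N _)) // orbF => ->; rewrite negbK => /eqP.
have [k /and3P[/eqP k3 ck ck2]] := suspended_gap n3 no_c1.
have k2n := suspended_lt ck2.
have ok : (k < n.+1)%N by lia.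
have ok1 : (k.+1 < n.+1)%N by lia.
pose w : 'I_n.+1 := Ordinal ok1.
pose W := ones_mod3 n.+1 n.
have wW : w \in W by rewrite inE /=; lia.
(* As 3 divides [n], removing [w] leaves at most [n/3 - 1] vertices. *)
suff : (n.+1 <= d + #|W :\ w| + 1)%N.
  have := card_ones_mod3 n.+1 n; rewrite -/W (cardsD1 w) wW.
  by move: #|_ :\ _| => W'; lia.
have zW : (ord_max : 'I_n.+1) \notin W by rewrite inE /= ltnn.
apply: (@pdim_lower_bound _ _ _ _ _ [set w; ord_max] w (Ordinal ok) pdG).
- by rewrite !inE eqxx.
- by rewrite !inE eqxx.
- by rewrite !inE -!val_eqE /=; lia.
- by rewrite !inE -!val_eqE /=; lia.
- by rewrite setD1K //; apply: ones_mod3_independent.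
- apply: (path_independent Gn) => [i|i j].
    rewrite !inE -!val_eqE /=; lia.
  rewrite !inE -!val_eqE /=; lia.
- move=> i j iX; rewrite inE => jXW.
  have [jn|jn] := ltnP j n; last first.
    move: jXW; rewrite !inE -!val_eqE /=; have := z_eq j jn; lia.
  have jW : j \notin W.
    by move: jXW; rewrite !inE -!val_eqE /=; lia.
  have [l lW [Glj lj]] := ones_mod3_dominates Gn (leqnSn n) jn jW.
  (* If only [w] dominates [j] here, then [j] is [k] or [k.+2]; both are adjacent to [w] and, being
     in [C], to [z]. *)
  have [lw|lw] := eqVneq l w; last first.
    by apply/orP; right; apply/exists_inP; exists l; rewrite ?in_setD1 ?lw.
  move: iX; rewrite !inE => /orP[]/eqP->; first by rewrite -lw Glj.
  rewrite adj_sym Gz //; apply/orP; left.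
  have jw : j != k.+1 :> nat.
    by apply: contraNneq jW => jk; rewrite (_ : j = w) //; apply: val_inj.
  suff : (j == k :> nat) || (j == k.+2 :> nat) by case/orP => /eqP->.
  by move: lj; rewrite lw /=; lia.
Qed.

End Suspension.

Theorem theorem5p5 (K : fieldType) (n : nat) (C : {set 'I_n}) :
  (0 < n)%N ->
  maxset (independent (path_graph n)) C ->
  pdim {mpoly K[n.+1]} (quot_mod (edge_gens K (suspension (path_graph n) C))) =
  omap succn (pdim {mpoly K[n]} (quot_mod (edge_gens K (path_graph n)))).
Proof.
move=> n_gt0 maxC.
rewrite (pdim_eq (suspension_upper_bound K maxC n_gt0)); last first.
  by move=> d /(suspension_lower_bound maxC n_gt0).
rewrite (@pdim_eq _ _ ((2 * n) %/ 3)) //.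
- rewrite -edge_var_gens0 -/(ev_pdim_le _ _ _ _).
  apply: (@ev_pdim_leW K n (#|set0 : {set 'I_n}| + (2 * n) %/ 3) _
    (initial_path n n) _ set0).
  + by apply: initial_path_upper_bound => // i; rewrite inE.
  + by [].
  + by rewrite cards0.
  + by move=> i j _ _; rewrite /= /initial_path_adj !ltn_ord.
(* For [n = 1] the claimed value is 0; otherwise it equals [n] minus the number of blocks of
   three. *)
- move=> d pdP; have [n1|n1] := leqP n 1; first by lia.
  suff : (n <= d + (n + 2) %/ 3)%N by lia.
  apply: (ones_mod3_lower_bound _ _ _ pdP) => //; first by rewrite n1 leqnn.
  by move=> j nj; have := ltn_ord j; lia.
Qed.
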